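(* Let $W$ be any finite real reflection group of rank $\ell$ with set of reflections $T$, root system $\Phi$, fixed choice of a positive system $\Phi^+$ and Coxeter number $h$. Let $\{\sigma_1,\sigma_2,\dots,\sigma_\ell\}$ be a choice of simple system for $\Phi$ such that $\{\sigma_1,\dots,\sigma_r\}$ and $\{\sigma_{r+1},\dots,\sigma_\ell\}$ are orthonormal sets for some $r$. Then $\Phi^+=\{\rho_1,\rho_2,\dots,\rho_{\ell h/2}\}$, where $\rho_i=t_{\sigma_1}t_{\sigma_2}\cdots t_{\sigma_{i-1}}(\sigma_i)$ for $1\le i\le \ell h/2$ and the $\sigma_j$ are indexed cyclically modulo $\ell$ (a recalled fact, proved by Steinberg under the additional assumption that $W$ is irreducible, which is stated not to be needed here). If $T$ is totally ordered by $$t_{\rho_1}<t_{\rho_2}<\cdots<t_{\rho_{\ell h/2}}$$ and $\gamma=t_{\sigma_1}t_{\sigma_2}\cdots t_{\sigma_\ell}$, then the natural edge labeling of $\mathrm{NC}_W(\gamma)$ with label set $T$ is an EL-labeling.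
   Context: $W$ acts faithfully by orthogonal transformations on an $\ell$-dimensional Euclidean space $V$ and is generated by orthogonal reflections. $\Phi$ is $W$-invariant and consists of one pair $\{\alpha,-\alpha\}$ of nonzero vectors for each reflection in $W$, orthogonal to its reflecting hyperplane; $t_\alpha$ is the orthogonal reflection in the hyperplane orthogonal to $\alpha$. A Coxeter element is the product of the simple reflections, in an arbitrary order, for any choice of simple system for $\Phi$; the Coxeter number $h$ is the order of any Coxeter element. For $w\in W$, $l_T(w)$ is the smallest $k$ such that $w$ is a product of $k$ reflections in $T$; $u\preceq v$ if and only if $l_T(u)+l_T(u^{-1}v)=l_T(v)$; $\mathrm{NC}_W(w)$ is the interval $[1,w]$ in $(W,\preceq)$, graded with rank function $l_T$. Every covering relation $(u,v)$ of $\mathrm{NC}_W(\gamma)$ satisfies $u^{-1}v\in T$; the natural edge labeling is $\lambda(u,v)=u^{-1}v$, with label set $T$. For an edge labeling $\lambda$ of a finite bounded graded poset with values in a totally ordered set, the label of an unrefinable chain $x_0<x_1<\cdots<x_r$ is $(\lambda(x_0,x_1),\dots,\lambda(x_{r-1},x_r))$; the chain is rising if the entries of its label strictly increase; chains of equal length are compared by the lexicographic order on their labels. The labeling is an EL-labeling if in every non-singleton interval there is a unique rising maximal chain and this chain is lexicographically smallest among all maximal chains of the interval.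
   Formalization: For reducible W the equality Φ⁺={ρ_i} can fail (e.g. A1×A2), so it is claimed only when the t_{ρ_i} are distinct (shown for irreducible W); in general only Φ⁺⊆{ρ_i} is claimed, and T is ordered by first occurrence in the list t_{ρ_1}, t_{ρ_2}, …. *)

(* Defs.v *)
From HB Require Import structures.
From mathcomp Require Import all_boot all_order all_fingroup all_algebra.
From mathcomp Require Import all_character.
From mathcomp Require Import boolp classical_sets reals.

Set Implicit Arguments.
Unset Strict Implicit.
Unset Printing Implicit Defensive.

Import Order.TTheory GRing.Theory Num.Theory GroupScope.
Local Open Scope ring_scope.

(** * Euclidean space *)

(* The Euclidean space is R^l, realized as the column vectors ['cV[R]_l].  A
   matrix acts on it by multiplication on the left, so that a product of group
   elements acts as the composite of functions, rightmost factor first. *)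
Section Euclidean.

Variables (R : realType) (l : nat).
Implicit Types (a u v : 'cV[R]_l) (M : 'M[R]_l).

Definition dotv u v : R := (u^T *m v) 0 0.

Definition orthogonal_mx M : Prop := M^T *m M = 1%:M.

(* v |-> v - 2 (a, v) / (a, a) a *)
Definition reflection_mx a : 'M[R]_l :=
  1%:M - (2 / dotv a a) *: (a *m a^T).

Definition orthonormal_seq (s : seq 'cV[R]_l) : Prop :=
  forall i j, (i < size s)%N -> (j < size s)%N ->
    dotv s`_i s`_j = (i == j)%:R.

End Euclidean.

(** * Finite real reflection groups *)

Section ReflectionGroups.

Variables (R : realType) (gT : finGroupType) (W : {group gT}) (l : nat).
Variable rW : mx_representation R W l.
Implicit Types (a : 'cV[R]_l) (sigma : l.-tuple 'cV[R]_l).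
Implicit Types (Phi PhiP : set 'cV[R]_l).

Definition reflections : {set gT} :=
  [set t : gT | (t \in W) && `[< exists2 a, a != 0 & rW t = reflection_mx a >]]%SET.

Definition reflection_group : Prop :=
  [/\ mx_faithful rW,
      (forall w, w \in W -> orthogonal_mx (rW w))
    & W :=: <<reflections>>].

(* [alpha t] and [- alpha t] are the two roots attached to the reflection t. *)
Definition root_system Phi : Prop :=
  (exists alpha : gT -> 'cV[R]_l,
     (forall t, t \in reflections ->
        alpha t != 0 /\ rW t = reflection_mx (alpha t)) /\
     (forall a, Phi a <->
        exists2 t, t \in reflections & a = alpha t \/ a = - alpha t)) /\
  (forall w a, w \in W -> Phi a -> Phi (rW w *m a)).

(* The roots on one side of a hyperplane that contains no root. *)
Definition positive_system Phi PhiP : Prop :=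
  exists2 v : 'cV[R]_l,
    (forall a, Phi a -> dotv v a != 0)
  & (forall a, PhiP a <-> Phi a /\ 0 < dotv v a).

(* A linearly independent family of roots such that every root is a linear
   combination of it with coefficients of the same sign.  The family has l
   members, where l is the dimension of the space: W has rank l. *)
Definition simple_system Phi sigma : Prop :=
  [/\ (forall i, Phi (tnth sigma i)),
      free sigma
    & forall a, Phi a -> exists2 c : 'I_l -> R,
        a = \sum_(i < l) c i *: tnth sigma i
      & (forall i, 0 <= c i) \/ (forall i, c i <= 0)].

(* The simple system whose associated positive system is PhiP. *)
Definition simple_system_of Phi PhiP sigma : Prop :=
  simple_system Phi sigma /\ (forall i, PhiP (tnth sigma i)).

(* The element t_a of W that acts as the reflection orthogonal to a (it is
   unique when rW is faithful); the junk value is 1. *)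
Definition root_reflection a : gT :=
  odflt 1%g [pick w in W | rW w == reflection_mx a].

Definition coxeter_element sigma : gT :=
  (\prod_(a <- sigma) root_reflection a)%g.

(* All Coxeter elements of W are conjugate, hence have the same order. *)
Definition coxeter_number sigma : nat := #[coxeter_element sigma]%g.

(* [rho sigma i] is the vector usually written rho_(i+1): indices start at 0
   here, both for sigma and for rho. *)
Definition rho sigma (i : nat) : 'cV[R]_l :=
  rW (\prod_(0 <= j < i) root_reflection (sigma`_(j %% l)%N))%g
    *m sigma`_(i %% l)%N.

Definition rho_seq sigma : seq 'cV[R]_l :=
  mkseq (rho sigma) (l * coxeter_number sigma)./2.

End ReflectionGroups.

(** * Absolute order and noncrossing partitions *)

Section AbsoluteOrder.

Variables (gT : finGroupType) (T : {set gT}).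
Implicit Types u v w : gT.

(* [(T ^+ k)%g] is the set of all products of k elements of T. *)
Lemma abs_length_subproof w :
  exists k, (w \notin <<T>>) || (w \in (T ^+ k)%g).
Proof.
have [/gen_prodgP[n [c cT ->]]|_] := boolP (w \in <<T>>); last by exists 0%N.
exists n; rewrite /=; elim: n c cT => [|n IHn] c cT.
  by rewrite big_ord0 expg0 inE.
by rewrite big_ord_recr expgSr mem_mulg // IHn.
Qed.

(* Zero outside the subgroup generated by T. *)
Definition abs_length w : nat := ex_minn (abs_length_subproof w).

Definition abs_le u v : bool :=
  (abs_length u + abs_length (u^-1 * v)%g == abs_length v)%N.

Definition NC (W : {set gT}) w : {set gT} :=
  [set u in W | abs_le u w]%SET.

Definition natural_label u v : gT := (u^-1 * v)%g.

End AbsoluteOrder.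

(** * EL-labelings *)

(* The poset is the set A ordered by le; labels are taken in the set Lam,
   ordered by the strict order lt. *)
Section ELLabeling.

Variables (P L : finType) (A : {set P}) (le : rel P).
Variables (Lam : {set L}) (lt : rel L) (lab : P -> P -> L).

Definition covers : rel P := fun x y =>
  [&& x \in A, y \in A, x != y, le x y
    & [forall z in A, le x z && le z y ==> (z == x) || (z == y)]].

(* x :: p is a maximal chain of the interval [x, y]. *)
Definition maximal_chain x y (p : seq P) : bool :=
  path covers x p && (last x p == y).

Definition chain_label x (p : seq P) : seq L := pairmap lab x p.

Definition rising x p : bool := sorted lt (chain_label x p).

Fixpoint lex_le (s1 s2 : seq L) : bool :=
  match s1, s2 with
  | [::], _ => true
  | _ :: _, [::] => false
  | a :: s1', b :: s2' => lt a b || (a == b) && lex_le s1' s2'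
  end.

Definition strict_total_order_on : Prop :=
  [/\ {in Lam, irreflexive lt}, {in Lam & &, transitive lt}
    & {in Lam &, forall a b, a != b -> lt a b || lt b a}].

Definition EL_labeling : Prop :=
  [/\ strict_total_order_on,
      (forall x y, covers x y -> lab x y \in Lam)
    & forall x y, x \in A -> y \in A -> x != y -> le x y ->
        exists p, [/\ maximal_chain x y p, rising x p,
          (forall q, maximal_chain x y q -> rising x q -> q = p)
        & (forall q, maximal_chain x y q ->
             lex_le (chain_label x p) (chain_label x q))]].

End ELLabeling.

(* The order t_1 < t_2 < ... given by a list [:: t_1; t_2; ...] of the elements
   to be ordered.  If the list has repetitions, then each element is placed at
   its first occurrence. *)
Definition list_lt (T : eqType) (s : seq T) : rel T :=
  fun x y => (index x s < index y s)%N.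

(* Main.v *)
(* On labels.  Since [1 - gamma] is invertible, one has the Euler form
   [E x y = ((1 - gamma)^-1 x, y)], whose symmetrization is the scalar product
   and for which [E (gamma x) y = - E y x].  If [gamma] is a product of the
   reflections in [a_1, ..., a_l], then [E a_i a_j = 0] for [i < j].  On the
   other hand [E (rho_n) y] is a positive multiple of the coordinate of
   [w^-1 y] on the simple root [sigma_n], where [rho_n = w sigma_n]; so if [s]
   comes before [t] in the order of reflections, their positive roots satisfy
   [E s t >= 0] and [E t s <= 0].  Consider a rising chain with roots
   [a_1, ..., a_k] and the least reflection, of root [b], below its product.
   If [b] came before [a_1], then [E b a_i >= 0] and triangularity would make
   [b] a nonnegative combination of the [a_i], and [E a_i b <= 0] would give
   [E b b <= 0], which is absurd.  Thus rising chains are greedy.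

   On the list of roots.  Let the products [c+] and [c-] of the two halves of
   the simple system act alternately on a root.  Each sign change is a step
   from [x] to [- x], after which the sequence retraces itself up to sign; as
   the sequence has period [2h], a sign change occurs in the first [h] steps.
   If the sign changes too early along the orbit of some simple root, the same
   holds for the adjacent simple roots, hence for all of them when [W] is
   irreducible, and a proper power of [gamma] is trivial. *)

Require Import Defs.
From mathcomp Require Import all_boot all_order all_fingroup all_algebra.
From mathcomp Require Import all_character.
From mathcomp Require Import boolp classical_sets reals.
From mathcomp Require Import cyclic ring lra zify.

Set Implicit Arguments.
Unset Strict Implicit.
Unset Printing Implicit Defensive.

Import Order.TTheory GRing.Theory Num.Theory.
Local Open Scope ring_scope.

(** * Products of reflections and the Euler form *)

Section EuclideanTheory.

Variables (R : realType) (l : nat).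
Implicit Types (a b u v : 'cV[R]_l) (M G : 'M[R]_l) (s : seq 'cV[R]_l).

Lemma dotvC u v : dotv u v = dotv v u.
Proof. by rewrite /dotv -[u^T *m v]trmxK trmx_mul trmxK mxE. Qed.

Lemma dotvDr u v w : dotv u (v + w) = dotv u v + dotv u w.
Proof. by rewrite /dotv mulmxDr mxE. Qed.

Lemma dotvZr k u v : dotv u (k *: v) = k * dotv u v.
Proof. by rewrite /dotv -scalemxAr mxE. Qed.

Lemma dotvNr u v : dotv u (- v) = - dotv u v.
Proof. by rewrite -scaleN1r dotvZr mulN1r. Qed.

Lemma dotvBr u v w : dotv u (v - w) = dotv u v - dotv u w.
Proof. by rewrite dotvDr dotvNr. Qed.

Lemma dotvDl u v w : dotv (v + w) u = dotv v u + dotv w u.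
Proof. by rewrite !(dotvC _ u) dotvDr. Qed.

Lemma dotvZl k u v : dotv (k *: v) u = k * dotv v u.
Proof. by rewrite !(dotvC _ u) dotvZr. Qed.

Lemma dotvNl u v : dotv (- v) u = - dotv v u.
Proof. by rewrite !(dotvC _ u) dotvNr. Qed.

Lemma dotvBl u v w : dotv (v - w) u = dotv v u - dotv w u.
Proof. by rewrite dotvDl dotvNl. Qed.

Lemma dotv0r u : dotv u 0 = 0.
Proof. by rewrite /dotv mulmx0 mxE. Qed.

Lemma dotv0l u : dotv 0 u = 0.
Proof. by rewrite dotvC dotv0r. Qed.

Lemma dotv_sumr I (r : seq I) (P : pred I) (F : I -> 'cV[R]_l) u :
  dotv u (\sum_(i <- r | P i) F i) = \sum_(i <- r | P i) dotv u (F i).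
Proof. by apply: (big_morph (dotv u)) => [v w|]; rewrite ?dotvDr ?dotv0r. Qed.

Lemma dotv_mulmxr M u v : dotv u (M *m v) = dotv (M^T *m u) v.
Proof. by rewrite /dotv trmx_mul trmxK mulmxA. Qed.

Lemma dotv_orthogonal M u v :
  orthogonal_mx M -> dotv (M *m u) (M *m v) = dotv u v.
Proof. by move=> oM; rewrite dotv_mulmxr mulmxA oM mul1mx. Qed.

Lemma dotv_eq0 u : (dotv u u == 0) = (u == 0).
Proof.
apply/eqP/eqP => [|->]; last exact: dotv0r.
rewrite /dotv mxE => /eqP; rewrite psumr_eq0 => [/allP u0|i _]; last first.
  by rewrite mxE -expr2 sqr_ge0.
apply/matrixP => i j; rewrite ord1 [RHS]mxE.
have := u0 i; rewrite mem_index_enum => /(_ isT) /=.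
by rewrite mxE mulf_eq0 orbb => /eqP.
Qed.

Lemma dotv_gt0 u : u != 0 -> 0 < dotv u u.
Proof.
rewrite -dotv_eq0 lt_neqAle eq_sym => -> /=.
by rewrite /dotv mxE sumr_ge0 // => i _; rewrite mxE -expr2 sqr_ge0.
Qed.

Lemma mulmx_cV_inj M G : (forall v : 'cV[R]_l, M *m v = G *m v) -> M = G.
Proof.
move=> eqMG; apply/matrixP => i j.
by have := congr1 (fun v : 'cV[R]_l => v i 0) (eqMG (delta_mx j 0));
  rewrite -!colE !mxE.
Qed.

Lemma reflection_mxE a v :
  reflection_mx a *m v = v - (2 / dotv a a * dotv a v) *: a.
Proof.
rewrite /reflection_mx mulmxBl mul1mx -scalemxAl -mulmxA.
by rewrite [a^T *m v]mx11_scalar mul_mx_scalar scalerA.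
Qed.

Lemma mulmx_reflection m (U : 'M[R]_(m, l)) a :
  U *m reflection_mx a = U - (2 / dotv a a) *: (U *m a *m a^T).
Proof. by rewrite /reflection_mx mulmxBr mulmx1 -scalemxAr mulmxA. Qed.

Lemma reflection_mxK a v :
  a != 0 -> reflection_mx a *m (reflection_mx a *m v) = v.
Proof.
rewrite -dotv_eq0 => a0; rewrite !reflection_mxE dotvBr dotvZr.
rewrite -addrA -opprD -scalerDl; set c := (X in X *: a).
by rewrite (_ : c = 0) ?scale0r ?subr0 // /c; field.
Qed.

Lemma reflection_mxZ k a :
  k != 0 -> reflection_mx (k *: a) = reflection_mx a.
Proof.
move=> k0; have [->|] := eqVneq a 0; first by rewrite scaler0.
rewrite -dotv_eq0 => a0; apply: mulmx_cV_inj => v; rewrite !reflection_mxE.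
rewrite !(dotvZl, dotvZr) scalerA; congr (_ - _ *: _).
by field; rewrite k0 a0.
Qed.

Lemma reflection_mxN a : reflection_mx (- a) = reflection_mx a.
Proof. by rewrite -scaleN1r reflection_mxZ // oppr_eq0 oner_eq0. Qed.

Lemma reflection_mx_conj M a : orthogonal_mx M ->
  reflection_mx (M *m a) = M *m reflection_mx a *m M^T.
Proof.
move=> oM; rewrite /reflection_mx dotv_orthogonal // mulmxBr mulmx1 mulmxBl.
rewrite -!scalemxAr -!scalemxAl trmx_mul !mulmxA (_ : M *m M^T = 1%:M) //.
exact: mulmx1C.
Qed.

(** * Displacement of a vector by a product of reflections *)

Fixpoint reflect_seq s v :=
  if s is a :: s' then reflection_mx a *m reflect_seq s' v else v.

Lemma reflect_seq_cat s1 s2 v :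
  reflect_seq (s1 ++ s2) v = reflect_seq s1 (reflect_seq s2 v).
Proof. by elim: s1 => //= a s1 ->. Qed.

Lemma sub_reflection_mem a v (U : {vspace 'cV[R]_l}) :
  a \in U -> v - reflection_mx a *m v \in U.
Proof.
by move=> Ua; rewrite reflection_mxE opprB addrCA subrr addr0 memvZ.
Qed.

Lemma memv_sub_span s1 s2 v :
  {subset s1 <= s2} -> v \in <<s1>>%VS -> v \in <<s2>>%VS.
Proof. by move=> /sub_span/subvP; apply. Qed.

Lemma sub_reflect_seq_span s v : v - reflect_seq s v \in <<s>>%VS.
Proof.
elim: s => [|a s IHs] /=; first by rewrite subrr mem0v.
rewrite -[X in X - _](subrK (reflect_seq s v)) -addrA memvD //.
  by apply: memv_sub_span IHs => x; rewrite inE orbC => ->.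
by rewrite sub_reflection_mem // memv_span ?mem_head.
Qed.

(** The reflection in [a], applied last, displaces by a multiple of [a], and the others displace by
    a vector in the span of [s]. If the total is zero, independence makes both parts vanish. *)
Lemma reflect_seq_fix s v :
  free s -> reflect_seq s v = v -> {in s, forall a, dotv a v = 0}.
Proof.
elim: s => //= a s IHs; rewrite free_cons => /andP[sa frs] fixv.
have a0 : a != 0 by apply: contraNneq sa => ->; rewrite mem0v.
set y := reflect_seq s v in fixv *.
have dy : dotv a y = 0.
  apply/eqP/negPn; apply: contra sa => dy.
  have := sub_reflect_seq_span s v; rewrite -/y -[in X in X - y]fixv.
  rewrite reflection_mxE addrAC subrr add0r memvN => ksa.
  have k0 : 2 / dotv a a * dotv a y != 0.
    by rewrite !mulf_neq0 ?invr_eq0 ?dotv_eq0 // pnatr_eq0.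
  by rewrite -(scale1r a) -(mulVf k0) -scalerA memvZ.
have yv : y = v by rewrite -fixv reflection_mxE dy mulr0 scale0r subr0.
move=> b; rewrite inE => /orP[/eqP->|]; first by rewrite -yv.
exact: IHs.
Qed.

(* A vector moved by [a] by the product of a free list must be fixed by the
   factors to the right of [a], since the displacements caused by the three
   parts of the product are independent. *)
Lemma reflect_seq_move s1 a s2 v : free (s1 ++ a :: s2) ->
  v - reflect_seq (s1 ++ a :: s2) v = a -> {in s2, forall b, dotv b v = 0}.
Proof.
move=> fr; rewrite reflect_seq_cat /= => mv.
have fr2 : free (a :: s2) by apply: catr_free fr.
have [sa frs2] : a \notin <<s2>>%VS /\ free s2.
  by move: fr2; rewrite free_cons => /andP.
apply: reflect_seq_fix => //.
set y := reflect_seq s2 v in mv *; set z := reflection_mx a *m y in mv.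
have /directv_addP dir : directv (<<s1>> + <<a :: s2>>).
  by move: fr; rewrite cat_free => /and3P[].
have [k Hk] : exists k, y - z = k *: a.
  by rewrite /z reflection_mxE opprB addrCA subrr addr0; eexists.
have : z - reflect_seq s1 z \in (<<s1>> :&: <<a :: s2>>)%VS.
  rewrite memv_cap sub_reflect_seq_span /=.
  have -> : z - reflect_seq s1 z = a - (v - y) - (y - z).
    rewrite -[in RHS]mv; move: (reflect_seq s1 z) => t.
    by apply/matrixP => i j; rewrite !mxE; ring.
  have aU : a \in <<a :: s2>>%VS by rewrite memv_span ?mem_head.
  rewrite Hk memvB ?memvZ // memvB //.
  apply: memv_sub_span (sub_reflect_seq_span s2 v) => x.
  by rewrite inE orbC => ->.
rewrite dir memv0 subr_eq0 => /eqP zE.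
rewrite -zE in mv.
have vyE : v - y = (1 - k) *: a.
  rewrite scalerBl scale1r -Hk -[in RHS]mv; move: (y) (z) => y' z'.
  by apply/matrixP => i j; rewrite !mxE; ring.
have := sub_reflect_seq_span s2 v; rewrite -/y vyE => kas.
suff k1 : 1 - k = 0.
  by apply/eqP; rewrite eq_sym -subr_eq0 vyE k1 scale0r.
apply/eqP; apply: contraNT sa => k1.
by rewrite -(scale1r a) -(mulVf k1) -scalerA memvZ.
Qed.

Lemma orth_span_eq0 s u :
  u \in <<s>>%VS -> {in s, forall a, dotv a u = 0} -> u = 0.
Proof.
move=> us ort; apply/eqP; rewrite -dotv_eq0.
rewrite [X in dotv _ X](coord_span (X := in_tuple s)) // dotv_sumr.
by rewrite big1 // => i _; rewrite dotvZr dotvC ort ?mulr0 ?mem_nth.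
Qed.

(** A kernel vector of [1 - G] is fixed by the product, hence orthogonal to all of [s], which
    spans. *)
Lemma unit_sub_reflect_seq G s : free s -> <<s>>%VS = fullv ->
  (forall v, reflect_seq s v = G *m v) -> 1%:M - G \in unitmx.
Proof.
move=> frs full sG; rewrite unitmxE unitfE -det_tr; apply/det0P => -[v v0 vG].
case/negP: v0; rewrite -trmx_eq0 -dotv_eq0.
have fixv : reflect_seq s v^T = v^T.
  apply/esym/eqP; rewrite sG -subr_eq0 -[X in X - _]mul1mx -mulmxBl.
  by rewrite -[1%:M - G]trmxK -trmx_mul vG trmx0.
have ort := reflect_seq_fix frs fixv.
by rewrite [v^T](orth_span_eq0 (s := s)) ?dotv0r ?full ?memvf //.
Qed.

Lemma orthonormal_cons a s : orthonormal_seq (a :: s) ->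
  [/\ dotv a a = 1, {in s, forall b, dotv a b = 0} & orthonormal_seq s].
Proof.
move=> on; split; first by have /= -> := on 0%N 0%N isT isT.
  move=> b bs; rewrite -(nth_index 0 bs).
  by rewrite -index_mem in bs; have /= -> := on 0%N (index b s).+1 isT bs.
by move=> i j il jl; have := on i.+1 j.+1 il jl.
Qed.

Lemma reflect_seq_orthonormal s v : orthonormal_seq s ->
  reflect_seq s v = v - \sum_(a <- s) (2 * dotv a v) *: a.
Proof.
elim: s => [|a s IHs] /=; first by rewrite big_nil subr0.
move=> /orthonormal_cons[aa as0 /IHs->].
have o : dotv a (\sum_(b <- s) (2 * dotv b v) *: b) = 0.
  by rewrite dotv_sumr big1_seq // => b /andP[_ bs]; rewrite dotvZr as0 ?mulr0.
by rewrite reflection_mxE aa divr1 dotvBr o subr0 big_cons opprD addrA addrAC.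
Qed.

(** * The Euler form of an orthogonal matrix without nonzero fixed vectors *)

Section EulerForm.

Variable G : 'M[R]_l.
Hypotheses (oG : orthogonal_mx G) (uG : 1%:M - G \in unitmx).

Definition euler x y := dotv (invmx (1%:M - G) *m x) y.

(** Together with [eulerP] this eliminates the inverse matrix: writing the arguments as [p - G p]
    reduces identities of the Euler form to the orthogonality of [G]. *)
Lemma euler_subE p y : euler (p - G *m p) y = dotv p y.
Proof.
rewrite /euler (_ : p - G *m p = (1%:M - G) *m p) ?mulKmx //.
by rewrite mulmxBl mul1mx.
Qed.

Lemma eulerP x : exists p : 'cV[R]_l, x = p - G *m p.
Proof.
exists (invmx (1%:M - G) *m x).
set p := invmx _ *m x; transitivity ((1%:M - G) *m p).
  by rewrite /p mulKVmx.
by rewrite mulmxBl mul1mx.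
Qed.

Lemma eulerDl x y z : euler (x + y) z = euler x z + euler y z.
Proof. by rewrite /euler mulmxDr dotvDl. Qed.

Lemma eulerZl k x z : euler (k *: x) z = k * euler x z.
Proof. by rewrite /euler -scalemxAr dotvZl. Qed.

Lemma eulerDr x y z : euler x (y + z) = euler x y + euler x z.
Proof. exact: dotvDr. Qed.

Lemma eulerZr k x z : euler x (k *: z) = k * euler x z.
Proof. exact: dotvZr. Qed.

Lemma euler_sym x y : euler x y + euler y x = dotv x y.
Proof.
have [[p ->] [q ->]] := (eulerP x, eulerP y); rewrite !euler_subE.
rewrite !(dotvBr, dotvBl) dotv_orthogonal // (dotvC (G *m p)) (dotvC q p).
ring.
Qed.

Lemma euler_diag x : euler x x = dotv x x / 2.
Proof. by rewrite -euler_sym; field. Qed.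

Lemma euler_gt0 x : x != 0 -> 0 < euler x x.
Proof. by move=> /dotv_gt0; rewrite euler_diag; lra. Qed.

(* The analogue of Serre duality for the Euler form. *)
Lemma euler_coxeter x y : euler (G *m x) y = - euler y x.
Proof.
have [[p ->] [q ->]] := (eulerP x, eulerP y); rewrite mulmxBr !euler_subE.
by rewrite !(dotvBr, dotvBl) dotv_orthogonal // (dotvC q) (dotvC q); ring.
Qed.

(** If [a = p - G p], then the product moves [p] by exactly [a], so [reflect_seq_move] makes [p]
    orthogonal to [s2]; and [E a b] is the scalar product of [p] and [b]. *)
Lemma euler_triangular s1 a s2 : free (s1 ++ a :: s2) ->
  (forall v, reflect_seq (s1 ++ a :: s2) v = G *m v) ->
  {in s2, forall b, euler a b = 0}.
Proof.
move=> fr sG b bs2; have [p aE] := eulerP a.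
rewrite aE euler_subE dotvC.
by apply: (reflect_seq_move fr _ bs2); rewrite sG.
Qed.

End EulerForm.

Lemma span_reflect_seq G s : 1%:M - G \in unitmx ->
  (forall v, reflect_seq s v = G *m v) -> <<s>>%VS = fullv.
Proof.
move=> uG sG; apply/eqP; rewrite eqEsubv subvf; apply/subvP => v _.
by have [p ->] := eulerP uG v; rewrite -sG sub_reflect_seq_span.
Qed.

(** Every vector is a displacement of [G], so the roots span the space; at most [l] spanning vectors
    are independent. *)
Lemma free_reflect_seq G s : 1%:M - G \in unitmx -> (size s <= l)%N ->
  (forall v, reflect_seq s v = G *m v) -> free s.
Proof.
move=> uG sl /(span_reflect_seq uG) sf.
rewrite /free eqn_leq dim_span sf dimvf dim_matrix /= mulr1.
exact: sl.
Qed.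

Lemma span_consP a s x :
  x \in <<a :: s>>%VS -> exists k y, [/\ y \in <<s>>%VS & x = k *: a + y].
Proof.
rewrite span_cons => /memv_addP[u /vlineP[k ->] [y ys ->]].
by exists k, y.
Qed.

(** * Lists of roots on which the Euler form is triangular *)

Section TriangularLists.

Variable G : 'M[R]_l.
Hypotheses (oG : orthogonal_mx G) (uG : 1%:M - G \in unitmx).
Local Notation E := (euler G).

Lemma euler_span_r a s x :
  {in s, forall b, E a b = 0} -> x \in <<s>>%VS -> E a x = 0.
Proof.
elim: s x => [|b s IHs] x ab.
  by rewrite span_nil memv0 => /eqP->; rewrite /euler dotv0r.
move=> /span_consP[k [y [ys ->]]].
rewrite eulerDr eulerZr ab ?mem_head // mulr0 add0r IHs // => c cs.
by rewrite ab // inE cs orbT.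
Qed.

Lemma euler_span_l a s x :
  {in s, forall b, E b a = 0} -> x \in <<s>>%VS -> E x a = 0.
Proof.
elim: s x => [|b s IHs] x ab.
  by rewrite span_nil memv0 => /eqP->; rewrite /euler mulmx0 dotv0l.
move=> /span_consP[k [y [ys ->]]].
rewrite eulerDl eulerZl ab ?mem_head // mulr0 add0r IHs // => c cs.
by rewrite ab // inE cs orbT.
Qed.

Definition euler_tri s := pairwise (fun a b => E a b == 0) s.

Lemma reflect_seq_tri s : (size s <= l)%N ->
  (forall v, reflect_seq s v = G *m v) -> euler_tri s.
Proof.
move=> sl sG; have frs := free_reflect_seq uG sl sG.
suff H s1 s2 : s1 ++ s2 = s -> euler_tri s2 by apply: (H [::]).
elim: s2 s1 => //= a s2 IHs s1 eqs; apply/andP; split; last first.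
  by apply: (IHs (rcons s1 a)); rewrite cat_rcons.
rewrite -eqs in frs sG.
by apply/allP => b /(euler_triangular uG frs sG) ->.
Qed.

(** By triangularity, pairing the first vector [a] with [x] gives the coordinate of [x] on [a] times
    [E a a > 0]. So the leading coordinates vanish one after the other. *)
Lemma span_cat_drop s1 s2 x : {in s1, forall a, a != 0} ->
  euler_tri (s1 ++ s2) -> x \in <<s1 ++ s2>>%VS ->
  {in s1, forall a, E a x = 0} -> x \in <<s2>>%VS.
Proof.
elim: s1 x => //= a s1 IHs x nz /andP[/allP ta tri] /span_consP[k [y [ys ->]]] z.
have ay : E a y = 0 by apply: euler_span_r ys => b /ta/eqP.
have a0 : a != 0 by rewrite nz ?mem_head.
have /eqP := z a (mem_head _ _).
rewrite eulerDr ay addr0 eulerZr mulf_eq0 (gt_eqF (euler_gt0 oG uG a0)) orbF.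
move=> /eqP k0; rewrite k0 scale0r add0r in z *.
by apply: IHs => // b bs; rewrite ?nz ?z // inE bs orbT.
Qed.

(** Mirror image of [span_cat_drop]: the last coordinate is read off by pairing [x] with the last
    vector. *)
Lemma span_cat_take s1 s2 x : {in s2, forall a, a != 0} ->
  euler_tri (s1 ++ s2) -> x \in <<s1 ++ s2>>%VS ->
  {in s2, forall a, E x a = 0} -> x \in <<s1>>%VS.
Proof.
elim/last_ind: s2 x => [|s2 a IHs] x nz; first by rewrite cats0.
rewrite -rcons_cat /euler_tri pairwise_rcons => /andP[/allP ta tri].
have perm : {subset rcons (s1 ++ s2) a <= a :: (s1 ++ s2)}.
  by move=> b; rewrite mem_rcons.
move=> /(memv_sub_span perm) /span_consP[k [y [ys ->]]] z.
have ya : E y a = 0 by apply: euler_span_l ys => b /ta/eqP.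
have a0 : a != 0 by rewrite nz // mem_rcons mem_head.
have := z a; rewrite mem_rcons mem_head => /(_ isT)/eqP.
rewrite eulerDl ya addr0 eulerZl mulf_eq0 (gt_eqF (euler_gt0 oG uG a0)) orbF.
move=> /eqP k0; rewrite k0 scale0r add0r in z *.
by apply: IHs => // b bs; rewrite ?nz ?z // mem_rcons inE bs orbT.
Qed.

(* The signs [0 <= E x a] force the coordinates of [x] on [s] to be
   nonnegative: read them off from the last one to the first. *)
Lemma euler_tri_cone s x g : {in s, forall a, a != 0} ->
  euler_tri s -> pairwise (fun a b => E b a <= 0) s ->
  x \in <<s>>%VS -> {in s, forall a, 0 <= E x a} ->
  {in s, forall a, dotv g a <= 0} -> dotv g x <= 0.
Proof.
elim: s x g => [|a s IHs] x g nz.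
  by move=> _ _; rewrite span_nil memv0 => /eqP-> _ _; rewrite dotv0r.
move=> /= /andP[/allP ta tri] /andP[/allP sa ob].
move=> /span_consP[k [y [ys ->]]] xs gs.
have nzs : {in s, forall b, b != 0} by move=> b bs; rewrite nz // inE bs orbT.
have ys0 : {in s, forall b, 0 <= E y b}.
  move=> b bs; have := xs b; rewrite inE bs orbT => /(_ isT).
  by rewrite eulerDl eulerZl (eqP (ta b bs)) mulr0 add0r.
have IHy := IHs y _ nzs tri ob ys ys0.
(* As a function of [y], [E y a] is the scalar product with a fixed vector, so the induction
   hypothesis applies with that vector as [g]. This is why [g] is kept general. *)
have ya : E y a <= 0.
  rewrite /euler dotvC dotv_mulmxr; apply: IHy => b bs.
  by rewrite -dotv_mulmxr dotvC; apply: sa.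
have a0 : 0 < E a a by rewrite euler_gt0 // nz ?mem_head.
have k0 : 0 <= k.
  have := xs a (mem_head _ _); rewrite eulerDl eulerZl => kay.
  by rewrite -(pmulr_lge0 _ a0); lra.
rewrite dotvDr dotvZr.
have ga : dotv g a <= 0 by rewrite gs ?mem_head.
have gy : dotv g y <= 0 by apply: IHy => b bs; rewrite gs // inE bs orbT.
by have := mulr_ge0_le0 k0 ga; lra.
Qed.

(** Two factorizations of [G] differ only in the middle. Triangularity of the second gives
    [E a x = 0] on [s1] and [E x a = 0] on [s2], which by triangularity of the first places [x] in
    the span of [s]. There the cone lemma yields [E x x <= 0]. *)
Lemma euler_tri_contra s1 s s' s2 x :
  (size (s1 ++ s ++ s2) <= l)%N -> (size (s1 ++ s' ++ s2) <= l)%N ->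
  (forall v, reflect_seq (s1 ++ s ++ s2) v = G *m v) ->
  (forall v, reflect_seq (s1 ++ s' ++ s2) v = G *m v) ->
  pairwise (fun a b => E b a <= 0) s ->
  x \in s' -> {in s, forall a, 0 <= E x a} -> {in s, forall a, E a x <= 0} ->
  False.
Proof.
move=> sz sz' sG sG' ob xs' xs sx.
have fr := free_reflect_seq uG sz sG; have fr' := free_reflect_seq uG sz' sG'.
have nz : {in s1 ++ s ++ s2, forall a, a != 0}.
  by move=> a /(free_not0 fr).
have x0 : x != 0.
  by apply: (free_not0 fr'); rewrite !mem_cat xs' orbT.
have tri := reflect_seq_tri sz sG; have tri' := reflect_seq_tri sz' sG'.
have E1x : {in s1, forall a, E a x = 0}.
  move=> a as1; move: tri'; rewrite /euler_tri pairwise_cat => /andP[/allrelP H _].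
  by apply/eqP/H; rewrite // mem_cat xs'.
have Ex2 : {in s2, forall a, E x a = 0}.
  move=> a as2; move: tri'; rewrite /euler_tri !pairwise_cat.
  by move=> /and4P[_ _ /allrelP H _]; apply/eqP/H.
have xin : x \in <<s1 ++ s ++ s2>>%VS.
  by rewrite (span_reflect_seq uG sG) memvf.
have nz1 : {in s1, forall a, a != 0}.
  by move=> a as1; rewrite nz // mem_cat as1.
have xin2 := span_cat_drop nz1 tri xin E1x.
have nz2 : {in s2, forall a, a != 0}.
  by move=> a as2; rewrite nz // !mem_cat as2 !orbT.
have [tri2 tris] : euler_tri (s ++ s2) /\ euler_tri s.
  move: tri; rewrite /euler_tri pairwise_cat => /and3P[_ _ tri].
  by split=> //; move: tri; rewrite pairwise_cat => /and3P[].
have xins := span_cat_take nz2 tri2 xin2 Ex2.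
have nzs : {in s, forall a, a != 0}.
  by move=> a as'; rewrite nz // !mem_cat as' !orbT.
(* This [g] represents the linear form [E _ x]. *)
have := euler_tri_cone (g := (invmx (1%:M - G))^T *m x) nzs tris ob xins xs.
rewrite -dotv_mulmxr dotvC -/(E x x) => H; move: (euler_gt0 oG uG x0).
rewrite ltNge H // => a as'; rewrite -dotv_mulmxr dotvC; exact: sx.
Qed.

End TriangularLists.

End EuclideanTheory.

(** * Absolute order and a criterion for EL-labelings *)

Section AbsoluteOrderTheory.

Variables (gT : finGroupType) (T : {set gT}) (W : {group gT}) (c : gT).
Hypotheses (WE : W :=: <<T>>%g) (cW : c \in W).
Hypothesis T_invol : {in T, forall t, (t * t = 1)%g}.
Hypothesis T1 : 1%g \notin T.
Hypothesis T_conj : {in T &, forall s t, (t ^ s)%g \in T}.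

Implicit Types (u v w x y z s t : gT) (p q : seq gT).

Local Notation len := (abs_length T).
Local Notation A := (NC T W c).
Local Notation le := (abs_le T).
Local Notation cov := (covers A le).
Local Notation lab := (@natural_label gT).

Lemma reflections_subW : {subset T <= W}.
Proof. by move=> t tT; rewrite WE mem_gen. Qed.

Lemma prod_in_expgs p : {subset p <= T} ->
  (\prod_(t <- p) t)%g \in (T ^+ size p)%g.
Proof.
elim: p => [|t p IHp] pT; first by rewrite big_nil expg0 inE.
rewrite big_cons expgS mem_mulg ?pT ?mem_head // IHp // => s sp.
by rewrite pT // inE sp orbT.
Qed.

Lemma expgsP k w : w \in (T ^+ k)%g ->
  exists p, [/\ size p = k, {subset p <= T} & w = (\prod_(t <- p) t)%g].
Proof.
elim: k w => [|k IHk] w.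
  by rewrite expg0 inE => /eqP->; exists [::]; rewrite big_nil.
rewrite expgS => /mulsgP[t v tT /IHk[p [pk pT ->]] ->].
exists (t :: p); split; rewrite ?big_cons //= ?pk // => s.
by rewrite inE => /orP[/eqP->|/pT].
Qed.

Lemma abs_length_prod p : {subset p <= T} ->
  (len (\prod_(t <- p) t)%g <= size p)%N.
Proof.
move=> pT; rewrite /abs_length; case: ex_minnP => k _; apply.
by rewrite prod_in_expgs ?orbT.
Qed.

Lemma reduced_word w : w \in W -> exists p,
  [/\ size p = len w, {subset p <= T} & w = (\prod_(t <- p) t)%g].
Proof.
rewrite WE => wT; apply: expgsP; rewrite /abs_length.
by case: ex_minnP => k; rewrite wT.
Qed.

Lemma abs_length1 : len 1%g = 0%N.
Proof.
apply/eqP; rewrite -leqn0; have := @abs_length_prod [::]; rewrite big_nil.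
exact.
Qed.

Lemma abs_length_eq0 w : w \in W -> len w = 0%N -> w = 1%g.
Proof. by move=> /reduced_word[p [<- _ ->]] /size0nil->; rewrite big_nil. Qed.

Lemma abs_length_ref t : t \in T -> (len t <= 1)%N.
Proof.
move=> tT; have := @abs_length_prod [:: t]; rewrite big_seq1; apply.
by move=> s; rewrite inE => /eqP->.
Qed.

Lemma abs_lengthM u v : u \in W -> v \in W ->
  (len (u * v)%g <= len u + len v)%N.
Proof.
move=> /reduced_word[p [<- pT ->]] /reduced_word[q [<- qT ->]].
rewrite -big_cat -size_cat abs_length_prod // => s.
by rewrite mem_cat => /orP[/pT|/qT].
Qed.

(** As reflections have length one, these are the reflections below [w] in the absolute order, that
    is, the possible first letters of its reduced words. *)
Definition descents w := [set t in T | (len (t^-1 * w)%g).+1 == len w]%SET.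

Lemma descentsP t w :
  reflect (t \in T /\ (len (t^-1 * w)%g).+1 = len w) (t \in descents w).
Proof. by rewrite inE; apply: (iffP andP) => -[tT /eqP]. Qed.

Lemma descent_ge t w : t \in T -> w \in W -> (len w <= (len (t^-1 * w)%g).+1)%N.
Proof.
move=> tT wW; have tW := reflections_subW tT.
rewrite -{1}[w](mulKVg t) (leq_trans (abs_lengthM tW _)) ?groupM ?groupV //.
by rewrite -add1n leq_add2r abs_length_ref.
Qed.

Lemma descents_reduced t w : w \in W -> t \in descents w -> exists p,
  [/\ size p = len w, {subset p <= T}, t \in p & w = (\prod_(t <- p) t)%g].
Proof.
move=> wW /descentsP[tT tw]; have tW := reflections_subW tT.
have vW : (t^-1 * w)%g \in W by rewrite groupM ?groupV.
have [p [pk pT pE]] := reduced_word vW; exists (t :: p).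
rewrite /= pk tw mem_head big_cons -pE mulKVg; split=> // s.
by rewrite inE => /orP[/eqP->|/pT].
Qed.

Lemma exists_descent w : w \in W -> w != 1%g -> exists t, t \in descents w.
Proof.
move=> wW w1; have [[|t p] [pk pT wE]] := reduced_word wW.
  by rewrite wE big_nil eqxx in w1.
have tT : t \in T by apply: pT; rewrite mem_head.
exists t; apply/descentsP; split => //; apply/eqP.
rewrite eqn_leq descent_ge // andbT.
rewrite -pk /= {1}wE big_cons mulKg ltnS abs_length_prod // => s sp.
by apply: pT; rewrite inE sp orbT.
Qed.

(** Conjugation moves [t] past [s]: [s^-1 w] is the reflection [t ^ s] times an element of length
    [len w - 2]. *)
Lemma descents_mul s t w : w \in W ->
  t \in descents w -> s \in descents (t^-1 * w)%g -> s \in descents w /\ s != t.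
Proof.
move=> wW /descentsP[tT tw] /descentsP[sT st].
have [sW tW] := (reflections_subW sT, reflections_subW tT).
have tV : (t^-1 = t)%g by apply/eqP; rewrite eq_invg_mul T_invol.
split; last first.
  by apply/eqP => E; move: st tw; rewrite E tV mulgA T_invol // mul1g => <-; lia.
apply/descentsP; split => //; apply/eqP; rewrite eqn_leq descent_ge // andbT.
rewrite -tw -st ltnS.
have -> : (s^-1 * w = (t ^ s) * (s^-1 * (t^-1 * w)))%g.
  by rewrite conjgE !mulgA !mulgK.
have tsW := reflections_subW (T_conj sT tT).
rewrite (leq_trans (abs_lengthM tsW _)) ?groupM ?groupV //.
by rewrite -[X in (_ <= X)%N]add1n leq_add2r abs_length_ref // T_conj.
Qed.

Lemma NCP x : reflect (x \in W /\ le x c) (x \in A).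
Proof. by rewrite inE; apply: andP. Qed.

Lemma NC_in x : x \in A -> x \in W.
Proof. by case/NCP. Qed.

(** The lengths of [x], [(x t)^-1 y] and [y^-1 c] add up to [len c - 1], and [t] has length at most
    one; so every use of subadditivity along the way is an equality. *)
Lemma NC_step x y t : x \in A -> y \in A -> le x y ->
  t \in descents (x^-1 * y)%g ->
  [/\ (x * t)%g \in A, le x (x * t)%g & le (x * t)%g y].
Proof.
move=> xA /NCP[yW /eqP yc] /eqP xy /descentsP[tT].
have xW := NC_in xA; have tW := reflections_subW tT.
rewrite mulgA -invMg => td.
have xtW : (x * t)%g \in W by rewrite groupM.
have ht := abs_length_ref tT.
have h1 := abs_lengthM xW tW.
have h2 : (len c <= len (x * t)%g + len ((x * t)^-1 * c)%g)%N.
  by rewrite -{1}[c](mulKVg (x * t)%g) abs_lengthM ?groupM ?groupV.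
have h3 : (len ((x * t)^-1 * c)%g <= len ((x * t)^-1 * y)%g + len (y^-1 * c)%g)%N.
  have -> : ((x * t)^-1 * c = ((x * t)^-1 * y) * (y^-1 * c))%g.
    by rewrite mulgA mulgK.
  by rewrite abs_lengthM ?groupM ?groupV.
have [e1 e2 e3] : [/\ len x + len t = len (x * t)%g,
    len (x * t)%g + len ((x * t)^-1 * y)%g = len y
    & len (x * t)%g + len ((x * t)^-1 * c)%g = len c]%N.
  by move: h1 h2 h3 td xy yc ht; clear; do !move: (len _) => ?; split; lia.
by split; [apply/NCP; split => // | |]; rewrite /abs_le ?mulKg; apply/eqP.
Qed.

Lemma covers_step x y t : x \in A -> y \in A -> le x y ->
  t \in descents (x^-1 * y)%g -> cov x (x * t)%g.
Proof.
move=> xA yA xy td; have [xtA xxt xty] := NC_step xA yA xy td.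
have /descentsP[tT _] := td; have xW := NC_in xA.
apply/and5P; split => //.
  by apply: contraNneq T1 => E; rewrite -(mulKg x t) -E mulVg in tT.
apply/forall_inP => z zA; apply/implyP => /andP[/eqP xz /eqP zxt].
have zW := NC_in zA; have xtW := NC_in xtA.
move: xxt; rewrite /abs_le mulKg => /eqP xt; have := abs_length_ref tT.
have [/eqP|xz0] := eqVneq (len (x^-1 * z)%g) 0%N.
  move=> /eqP /abs_length_eq0; rewrite groupM ?groupV // => /(_ isT)/eqP.
  by rewrite -eq_mulVg1 eq_sym => ->.
move=> t1; have /abs_length_eq0 : len (z^-1 * (x * t))%g = 0%N.
  by move: xz0 xz zxt xt t1; clear; do !move: (len _) => ?; lia.
rewrite groupM ?groupV // => /(_ isT)/eqP; rewrite -eq_mulVg1 => ->.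
exact: orbT.
Qed.

(** A descent [t] of [x^-1 y] puts [x t] between [x] and [y], so a cover forces [x t = y]. *)
Lemma covers_label x y : cov x y ->
  [/\ x \in A, y \in A, lab x y \in T & len y = (len x).+1].
Proof.
move=> /and5P[xA yA xy le_xy /forall_inP cxy].
have xW := NC_in xA; have yW := NC_in yA.
have wW : (x^-1 * y)%g \in W by rewrite groupM ?groupV.
have [|t td] := exists_descent wW; first by rewrite -eq_mulVg1.
have [xtA xxt xty] := NC_step xA yA le_xy td.
have /descentsP[tT _] := td.
have /orP[/eqP E|/eqP E] : (x * t == x)%g || (x * t == y)%g.
- by have := cxy _ xtA; rewrite xxt xty.
- by case/negP: T1; rewrite -(mulKg x t) E mulVg in tT.
have tE : (x^-1 * y = t)%g by rewrite -E mulKg.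
split; rewrite /natural_label ?tE //.
move: le_xy; rewrite /abs_le tE => /eqP <-; rewrite -addn1; congr addn.
apply/eqP; rewrite eqn_leq abs_length_ref // lt0n; apply/eqP => t0.
by case/negP: T1; rewrite -(abs_length_eq0 (reflections_subW tT) t0).
Qed.

Lemma maximal_chainP x y q : maximal_chain A le x y q ->
  [/\ {subset chain_label lab x q <= T},
      (\prod_(t <- chain_label lab x q) t)%g = (x^-1 * y)%g
    & len y = (len x + size q)%N].
Proof.
rewrite /maximal_chain; elim: q x => [|z q IHq] x /=.
  by move=> /eqP->; rewrite big_nil mulVg addn0.
rewrite -andbA => /andP[/covers_label[_ _ labT lz] /IHq[qT qE ->]].
split; last by rewrite lz addSnnS.
  by move=> t; rewrite inE => /orP[/eqP->|/qT].
by rewrite big_cons qE /natural_label mulgA mulgK.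
Qed.

Lemma maximal_chain_le x y q : x \in W -> y \in W ->
  maximal_chain A le x y q -> le x y /\ len (x^-1 * y)%g = size q.
Proof.
move=> xW yW /maximal_chainP[qT qE yx].
have xyW : (x^-1 * y)%g \in W by rewrite groupM ?groupV.
have h1 := abs_length_prod qT; rewrite qE size_pairmap in h1.
have h2 := abs_lengthM xW xyW; rewrite mulKVg in h2.
have E : len (x^-1 * y)%g = size q.
  by apply/eqP; rewrite eqn_leq h1 -(leq_add2l (len x)) -yx h2.
by rewrite /abs_le E yx.
Qed.

Lemma maximal_chain_descent x y z q : x \in A ->
  maximal_chain A le x y (z :: q) -> lab x z \in descents (x^-1 * y)%g.
Proof.
move=> xA ch; have /andP[/= /andP[xz zq] /eqP qy] := ch.
have [_ zA labT _] := covers_label xz.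
have yA : y \in A.
  rewrite -qy; elim: q z zA zq {ch xz labT qy} => //= z' q IHq z zA /andP[zz'].
  by apply: IHq; case/covers_label: zz'.
have [_ E] := maximal_chain_le (NC_in xA) (NC_in yA) ch.
have zch : maximal_chain A le z y q by rewrite /maximal_chain zq qy eqxx.
have [_ E'] := maximal_chain_le (NC_in zA) (NC_in yA) zch.
apply/descentsP; split => //; rewrite /natural_label invMg invgK mulgA mulgK.
by rewrite E' E.
Qed.

(** * A greedy criterion for EL-labelings *)

Section ELCriterion.

Variable ts : seq gT.
Hypothesis sTts : {subset T <= ts}.
Local Notation lt := (list_lt ts).

Hypothesis rising_min : forall x y z q t, x \in A -> y \in A ->
  maximal_chain A le x y (z :: q) -> rising lt lab x (z :: q) ->
  t \in descents (x^-1 * y)%g -> ~~ lt t (lab x z).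

Lemma index_T_inj s t : s \in T -> index s ts = index t ts -> s = t.
Proof.
move=> /sTts sts E; rewrite -(nth_index 1%g sts) E nth_index //.
by rewrite -index_mem -E index_mem.
Qed.

Lemma list_lt_total : strict_total_order_on T lt.
Proof.
split=> [t _|t s u _ _ _|s t sT tT st]; first exact: ltnn.
  exact: ltn_trans.
rewrite /list_lt -neq_ltn; apply: contraNneq st => E; apply/eqP.
exact: index_T_inj.
Qed.

(* The chain that takes the least available label at every step is rising,
   and no other rising chain can start differently. *)
Lemma EL_of_rising_min : EL_labeling A le T lt lab.
Proof.
split; first exact: list_lt_total.
  by move=> x y /covers_label[].
move=> x y xA yA _; move: {2}(len _) (erefl (len (x^-1 * y)%g)) => d.
elim: d x xA => [|d IHd] x xA dE le_xy.
  have /abs_length_eq0 := dE; rewrite groupM ?groupV ?NC_in // => /(_ isT)/eqP.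
  rewrite -eq_mulVg1 => /eqP xy; subst y; exists [::].
  have nil q : maximal_chain A le x x q -> q = [::].
    move=> /(maximal_chain_le (NC_in xA) (NC_in xA))[_]; rewrite dE.
    by move=> /esym/size0nil.
  by split=> //; [rewrite /maximal_chain /= | move=> q /nil].
have xW := NC_in xA; have yW := NC_in yA.
have wW : (x^-1 * y)%g \in W by rewrite groupM ?groupV.
have [|t0 t0d] := exists_descent wW.
  by apply/eqP => w1; rewrite w1 abs_length1 in dE.
case: (@arg_minnP _ t0 (mem (descents (x^-1 * y)%g)) (fun t => index t ts) t0d).
move=> t td tmin; have [zA le_xz le_zy] := NC_step xA yA le_xy td.
have xz := covers_step xA yA le_xy td.
set z := (x * t)%g in zA le_xz le_zy xz.
have labE : lab x z = t by rewrite /natural_label mulKg.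
have zy : (z^-1 * y = t^-1 * (x^-1 * y))%g by rewrite invMg mulgA.
have /descentsP[tT td'] := td.
have [|p [pch prise puniq plex]] := IHd z zA _ le_zy.
  by apply: succn_inj; rewrite zy td' dE.
have chain_head z' q : maximal_chain A le x y (z' :: q) ->
    (index t ts <= index (lab x z') ts)%N /\ (lab x z' = t -> z' = z).
  move=> ch; split; first by apply: tmin; apply: maximal_chain_descent ch.
  by rewrite /natural_label => E; rewrite /z -E mulKVg.
have chain_tail z' q : maximal_chain A le x y (z' :: q) ->
    maximal_chain A le z' y q.
  by rewrite /maximal_chain /= -andbA => /andP[].
have nonempty q : maximal_chain A le x y q -> q <> [::].
  by move=> ch q0; have [_] := maximal_chain_le xW yW ch; rewrite q0 dE.
exists (z :: p); split.
- by case/andP: pch => pp py; rewrite /maximal_chain /= xz pp py.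
- rewrite /rising /chain_label /= labE; case: p pch prise {puniq plex} => //= z' p.
  move=> pch prise; apply/andP; split; last exact: prise.
  (* The second label is also a descent of [x^-1 y] and differs from [t], so minimality of [t]
     places it after [t]. *)
  have := maximal_chain_descent zA pch; rewrite zy => /(descents_mul wW td)[sd st].
  rewrite /list_lt ltn_neqAle tmin // andbT.
  by apply: contraNneq st => /(index_T_inj tT) ->.
- move=> [|z' q] ch rise; first by case: (nonempty [::]).
  (* The first label of a rising chain is not after [t] by hypothesis, and not before it by
     minimality. *)
  have := rising_min xA yA ch rise td; rewrite /list_lt -leqNgt => le1.
  have [le2 zE] := chain_head z' q ch.
  have tE : lab x z' = t.
    by apply/esym/index_T_inj => //; apply/eqP; rewrite eqn_leq le2.
  rewrite zE // in ch rise *; congr cons; apply: puniq; first exact: chain_tail ch.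
  exact: path_sorted rise.
move=> [|z' q] ch; first by case: (nonempty [::]).
have [le2 zE] := chain_head z' q ch; rewrite /chain_label /= labE.
(* Either the chains share their first step, or the first label already decides the comparison. *)
move: le2; rewrite leq_eqVlt => /orP[/eqP/(index_T_inj tT)/esym tE|]; last first.
  by rewrite /list_lt => ->.
rewrite tE eqxx; apply/orP; right; rewrite zE // in ch *.
exact: plex (chain_tail _ _ ch).
Qed.

End ELCriterion.

End AbsoluteOrderTheory.

(** * Root systems and the sequence rho *)

Section RootSystem.

Variables (R : realType) (gT : finGroupType) (W : {group gT}).
Variables (l : nat) (rW : mx_representation R W l).
Variables (Phi PhiP : set 'cV[R]_l) (sigma : l.-tuple 'cV[R]_l).
Hypotheses (hW : reflection_group rW) (hPhi : root_system rW Phi).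
Hypotheses (hPhiP : positive_system Phi PhiP).
Hypothesis hsigma : simple_system_of Phi PhiP sigma.

Implicit Types (a x y : 'cV[R]_l) (w t : gT) (n m : nat).

Local Notation T := (reflections rW).
Local Notation gamma := (coxeter_element rW sigma).
Local Notation refl := (root_reflection rW).
Local Notation rho := (rho rW sigma).
Local Notation "w · x" := (rW w *m x) (at level 40, x at level 39).

Lemma rW_inj : {in W &, injective rW}.
Proof. by case: hW => + _ _; apply: mx_faithful_inj. Qed.

Lemma rW_orthogonal w : w \in W -> orthogonal_mx (rW w).
Proof. by case: hW => _ + _; apply. Qed.

Lemma act1 x : 1%g · x = x.
Proof. by rewrite repr_mx1 mul1mx. Qed.

Lemma actM w t x : w \in W -> t \in W -> (w * t)%g · x = w · (t · x).
Proof. by move=> wW tW; rewrite repr_mxM ?mulmxA. Qed.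

Lemma actVK w x : w \in W -> w · (w^-1%g · x) = x.
Proof. by move=> wW; rewrite -actM ?groupV // mulgV act1. Qed.

Lemma actKV w x : w \in W -> w^-1%g · (w · x) = x.
Proof. by move=> wW; rewrite -actM ?groupV // mulVg act1. Qed.

Lemma act_inj w : w \in W -> injective (fun x => w · x).
Proof. by move=> wW x y /(congr1 (fun z => w^-1%g · z)); rewrite !actKV. Qed.

Lemma act_faithful w t : w \in W -> t \in W ->
  (forall x, w · x = t · x) -> w = t.
Proof. by move=> wW tW wt; apply: rW_inj => //; apply: mulmx_cV_inj. Qed.

Lemma reflectionsP t :
  reflect (t \in W /\ exists2 a, a != 0 & rW t = reflection_mx a) (t \in T).
Proof.
rewrite inE; apply: (iffP andP) => -[tW].
  by move/asboolP=> ta.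
by move=> ta; split=> //; apply/asboolP.
Qed.

Lemma reflections_sub : {subset T <= W}.
Proof. by move=> t /reflectionsP[]. Qed.

Lemma PhiN a : Phi a -> Phi (- a).
Proof.
case: hPhi => -[alpha [_ PE]] _ /PE[t tT [->|->]]; apply/PE; exists t => //.
  by right.
by left; rewrite opprK.
Qed.

Lemma Phi_act w a : w \in W -> Phi a -> Phi (w · a).
Proof. by case: hPhi => _; apply. Qed.

Lemma Phi_refl a : Phi a ->
  [/\ a != 0, refl a \in T & rW (refl a) = reflection_mx a].
Proof.
case: hPhi => -[alpha [alphaP PE]] _ /PE[t tT aE].
have [a0 ta] := alphaP t tT.
have {}aE : a != 0 /\ rW t = reflection_mx a.
  by case: aE => ->; rewrite ?oppr_eq0 ?reflection_mxN.
have tW := reflections_sub tT.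
suff -> : refl a = t by case: aE.
rewrite /root_reflection; case: pickP => [w /andP[wW /eqP wa]|].
  by apply: rW_inj; rewrite // wa aE.2.
by move=> /(_ t); rewrite tW aE.2 eqxx.
Qed.

Local Opaque root_reflection reflection_mx.

Lemma refl_in a : Phi a -> refl a \in W.
Proof. by move=> /Phi_refl[_ /reflections_sub]. Qed.

Lemma reflE a x : Phi a -> refl a · x = x - (2 / dotv a a * dotv a x) *: a.
Proof. by move=> /Phi_refl[_ _ ->]; rewrite reflection_mxE. Qed.

Lemma reflK a x : Phi a -> refl a · (refl a · x) = x.
Proof. by move=> /Phi_refl[a0 _ ->]; rewrite reflection_mxK. Qed.

Lemma refl_sqr a : Phi a -> (refl a * refl a = 1)%g.
Proof.
move=> Pa; have aW := refl_in Pa.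
apply: act_faithful; rewrite ?groupM // => x.
by rewrite actM // reflK // act1.
Qed.

Lemma reflV a : Phi a -> ((refl a)^-1 = refl a)%g.
Proof. by move=> Pa; apply/eqP; rewrite eq_invg_mul refl_sqr. Qed.

Lemma refl_act w a : w \in W -> Phi a ->
  (refl (w · a) = w * refl a * w^-1)%g.
Proof.
move=> wW Pa; have [_ aT aE] := Phi_refl Pa.
have [_ waT waE] := Phi_refl (Phi_act wW Pa).
apply: rW_inj; rewrite ?groupM ?groupV ?refl_in //; first exact: Phi_act.
rewrite waE reflection_mx_conj; last exact: rW_orthogonal.
rewrite !repr_mxM ?groupM ?groupV ?refl_in // aE; congr (_ *m _).
rewrite -[LHS]mulmx1 -(repr_mx1 rW) -(mulgV w) repr_mxM ?groupV // mulmxA.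
by rewrite rW_orthogonal // mul1mx.
Qed.

Lemma Phi_refl_eq a b : Phi a -> Phi b -> refl a = refl b -> a = b \/ a = - b.
Proof.
move=> Pa Pb ab; have [[_ aT aE] [_ _ bE]] := (Phi_refl Pa, Phi_refl Pb).
case: hPhi => -[alpha [alphaP PE]] _.
have key c : Phi c -> c = alpha (refl c) \/ c = - alpha (refl c).
  move=> Pc; have /PE[t tT cE] := Pc; have [_ _ E] := Phi_refl Pc.
  have [_ tE] := alphaP t tT; suff -> : refl c = t by [].
  apply: (rW_inj (refl_in Pc) (reflections_sub tT)).
  by rewrite E tE; case: cE => ->; rewrite ?reflection_mxN.
have := key a Pa; have := key b Pb; rewrite ab {key ab}; move: (alpha _) => c.
by move=> [->|->] [->|->]; rewrite ?opprK; [left|right|right|left].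
Qed.

Lemma refl_opp a : Phi a -> refl (- a) = refl a.
Proof.
move=> Pa; apply: (rW_inj (refl_in (PhiN Pa)) (refl_in Pa)).
have [_ _ ->] := Phi_refl Pa; have [_ _ ->] := Phi_refl (PhiN Pa).
exact: reflection_mxN.
Qed.

(** Proportional roots define the same reflection, which has only two roots. *)
Lemma Phi_scale a (k : R) : Phi a -> Phi (k *: a) -> k *: a = a \/ k *: a = - a.
Proof.
move=> Pa Pka; have [[_ aT aE] [ka0 kaT kaE]] := (Phi_refl Pa, Phi_refl Pka).
apply: (Phi_refl_eq Pka Pa); apply: (rW_inj (refl_in Pka) (refl_in Pa)).
rewrite aE kaE reflection_mxZ //; apply: contraNneq ka0 => ->.
by rewrite scale0r.
Qed.

(** * Simple roots and signs of roots *)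

Lemma sigma_free : free sigma.
Proof. by case: hsigma => -[]. Qed.

Lemma span_sigma : <<sigma>>%VS = fullv.
Proof.
apply/eqP; rewrite eqEdim subvf dimvf dim_matrix (eqP sigma_free) size_tuple.
by rewrite mulr1 leqnn.
Qed.

Local Notation coef i x := (coord sigma i x).

Lemma coefE x : x = \sum_(i < l) coef i x *: sigma`_i.
Proof. by apply: coord_span; rewrite span_sigma memvf. Qed.

Lemma coef_sigma (i j : 'I_l) : coef i sigma`_j = (i == j)%:R.
Proof. by rewrite coord_free ?sigma_free // eq_sym. Qed.

Lemma coef_inj x y : (forall i, coef i x = coef i y) -> x = y.
Proof.
by move=> xy; rewrite (coefE x) (coefE y); apply: eq_bigr => i _; rewrite xy.
Qed.

Lemma Phi_sigma (i : 'I_l) : Phi sigma`_i.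
Proof. by case: hsigma => -[+ _ _] _ => /(_ i); rewrite (tnth_nth 0). Qed.

(** Sign by coordinates on the simple roots, for arbitrary vectors; on roots, [PhiPE] identifies it
    with membership in [PhiP], which is given by a separating vector. *)
Definition pos x := [forall i, 0 <= coef i x].

Lemma posP x : reflect (forall i, 0 <= coef i x) (pos x).
Proof. exact: forallP. Qed.

Lemma pos_sigma (i : 'I_l) : pos sigma`_i.
Proof. by apply/posP => j; rewrite coef_sigma ler0n. Qed.

Lemma pos_antisym x : pos x -> pos (- x) -> x = 0.
Proof.
move=> /posP x0 /posP x1; apply: coef_inj => i; rewrite linear0.
by apply/le_anti; rewrite x0 andbT -oppr_ge0 -linearN x1.
Qed.

Lemma Phi_posN a : Phi a -> pos (- a) = ~~ pos a.
Proof.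
move=> Pa; have [a0 _ _] := Phi_refl Pa.
have H : pos a \/ pos (- a).
  case: hsigma => -[_ _ /(_ a Pa)[c aE [c0|c0]]] _; [left|right];
  apply/posP => i; rewrite ?linearN /= {}aE; under eq_bigr do rewrite (tnth_nth 0);
  by rewrite coord_sum_free ?sigma_free // oppr_ge0.
case: (boolP (pos a)) H => [pa _|_ [] //].
by apply/negP => /(pos_antisym pa) a00; rewrite a00 eqxx in a0.
Qed.

Lemma PhiPE a : PhiP a <-> Phi a /\ pos a.
Proof.
case: hPhiP => v v0 PE.
have key b : Phi b -> pos b -> 0 < dotv v b.
  move=> Pb /posP pb; rewrite lt_neqAle eq_sym v0 //= (coefE b) dotv_sumr.
  apply: sumr_ge0 => i _; rewrite dotvZr mulr_ge0 //.
  case: hsigma => _ /(_ i) /PE[_]; rewrite (tnth_nth 0); exact: ltW.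
rewrite PE; split=> -[Pa pa]; split=> //; last exact: key.
apply/negPn/negP; rewrite -Phi_posN // => /(key _ (PhiN Pa)).
by rewrite dotvNr; lra.
Qed.

Lemma coef_reflect (i j : 'I_l) x :
  i != j -> coef i (refl sigma`_j · x) = coef i x.
Proof.
move=> ij; rewrite reflE; last exact: Phi_sigma.
by rewrite linearB linearZ /= coef_sigma (negPf ij) mulr0 subr0.
Qed.

(** A simple reflection changes one coordinate only, so a positive root that it makes negative has
    all other coordinates zero and is a multiple of [sigma_j]. *)
Lemma pos_flip (j : 'I_l) x :
  Phi x -> pos x -> ~~ pos (refl sigma`_j · x) -> x = sigma`_j.
Proof.
move=> Px px; have Pj := Phi_sigma j.
rewrite -Phi_posN; last by apply: Phi_act => //; apply: refl_in.
move=> /posP nx; have xE : x = coef j x *: sigma`_j.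
  apply: coef_inj => i; rewrite linearZ /= coef_sigma.
  have [->|ij] := eqVneq i j; first by rewrite mulr1.
  rewrite mulr0; apply/le_anti; rewrite (posP _ px) andbT.
  by have := nx i; rewrite linearN /= coef_reflect // oppr_ge0.
have := Px; rewrite {1}xE => /(Phi_scale Pj); rewrite -xE => -[//|xN].
have [/negP + _ _] := Phi_refl Px; case; apply/eqP/pos_antisym => //.
by rewrite xN opprK pos_sigma.
Qed.

Lemma sigma_inj (i j : 'I_l) : sigma`_i = sigma`_j -> i = j.
Proof.
move=> /(congr1 (coord sigma i)) /eqP; rewrite !coef_sigma eqxx.
by rewrite eqr_nat; case: (eqVneq i j).
Qed.

Lemma sigma_neqN (i j : 'I_l) : sigma`_i <> - sigma`_j.
Proof.
move=> /(congr1 pos); rewrite pos_sigma Phi_posN ?pos_sigma //.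
exact: Phi_sigma.
Qed.

(** Reflecting [sigma_j] in [sigma_i] keeps the coordinate 1 on [sigma_j], so the result is
    positive; its coordinate on [sigma_i] has the opposite sign to the scalar product. *)
Lemma sigma_obtuse (i j : 'I_l) : i != j -> dotv sigma`_i sigma`_j <= 0.
Proof.
move=> ij; have Pi := Phi_sigma i; have Pj := Phi_sigma j.
have [i0 _ _] := Phi_refl Pi; have ji : j != i by rewrite eq_sym.
have Px : Phi (refl sigma`_i · sigma`_j) by apply: Phi_act => //; apply: refl_in.
have px : pos (refl sigma`_i · sigma`_j).
  apply/negPn/negP; rewrite -Phi_posN // => /posP/(_ j).
  by rewrite linearN /= coef_reflect // coef_sigma eqxx oppr_ge0 ler10.
have := posP _ px i; rewrite reflE // linearB linearZ /= !coef_sigma eqxx.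
by rewrite (negPf ij) sub0r mulr1 oppr_ge0 pmulr_rle0 // divr_gt0 ?dotv_gt0.
Qed.

Lemma Phi_dim a : Phi a -> (0 < l)%N.
Proof.
move=> /Phi_refl[+ _ _]; case: (posnP l) => // l0 /negP[]; apply/eqP.
by apply/matrixP => i; move: (ltn_ord i); rewrite {2}l0.
Qed.

Local Notation wpre n :=
  (\prod_(0 <= j < n) root_reflection rW (sigma`_(j %% l)%N))%g.

Lemma gammaE : gamma = wpre l.
Proof.
rewrite /coxeter_element (big_nth 0) size_tuple big_nat [RHS]big_nat.
by apply: eq_bigr => i /andP[_ il]; rewrite modn_small.
Qed.

Lemma rW_prod_seq s x : (forall a, a \in s -> Phi a) ->
  (\prod_(a <- s) refl a)%g \in W /\
  (\prod_(a <- s) refl a)%g · x = reflect_seq s x.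
Proof.
elim: s => [|a s IHs] Ps; first by rewrite big_nil group1 act1.
have Pa := Ps a (mem_head _ _).
have [|sW sx] := IHs; first by move=> b bs; apply: Ps; rewrite inE bs orbT.
rewrite big_cons groupM ?refl_in // actM ?refl_in // sx /=.
by have [_ _ ->] := Phi_refl Pa.
Qed.

Lemma Phi_sigma_mem a : a \in sigma -> Phi a.
Proof.
move=> asig; rewrite -(nth_index 0 asig).
have il : (index a sigma < l)%N.
  by rewrite -[X in (_ < X)%N](size_tuple sigma) index_mem.
exact: (Phi_sigma (Ordinal il)).
Qed.

Lemma gamma_in : gamma \in W.
Proof. by have [] := rW_prod_seq 0 Phi_sigma_mem. Qed.

Lemma gamma_reflect_seq x : reflect_seq sigma x = gamma · x.
Proof. by have [_ ->] := rW_prod_seq x Phi_sigma_mem. Qed.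

Lemma gamma_unit : 1%:M - rW gamma \in unitmx.
Proof.
exact: unit_sub_reflect_seq sigma_free span_sigma gamma_reflect_seq.
Qed.

Lemma gamma_orthogonal : orthogonal_mx (rW gamma).
Proof. exact: rW_orthogonal gamma_in. Qed.

(** * The Euler form on the sequence of roots *)

Section Rho.

Hypothesis l_gt0 : (0 < l)%N.

Definition letter n : 'I_l := Ordinal (ltn_pmod n l_gt0).

Lemma letter_neq n m :
  (m < n)%N -> (n < m + l)%N -> letter n != letter m.
Proof.
move=> mn nl; apply/eqP => /(congr1 val) /= /eqP.
have dl : (n - m < l)%N by lia.
have d0 : (0 < n - m)%N by rewrite subn_gt0.
rewrite -(subnKC (ltnW mn)) -[X in _ == X %[mod l]]addn0 eqn_modDl mod0n.
by rewrite (modn_small dl) eqn0Ngt d0.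
Qed.

Lemma Phi_letter n : Phi sigma`_(n %% l)%N.
Proof. exact: (Phi_sigma (letter n)). Qed.

Lemma wpre_in n : wpre n \in W.
Proof. by apply: group_prod => i _; apply/refl_in/Phi_letter. Qed.

Lemma Phi_rho n : Phi (rho n).
Proof. exact: Phi_act (wpre_in n) (Phi_letter n). Qed.

Lemma wpreD n m :
  wpre (n + m) = (wpre n * \prod_(0 <= j < m) refl sigma`_((n + j) %% l)%N)%g.
Proof.
rewrite (big_cat_nat (leq0n n) (leq_addr m n)) /=.
congr (_ * _)%g.
by rewrite -{1}[n]add0n big_addn addKn; apply: eq_bigr => j _; rewrite addnC.
Qed.

Lemma wpre_gamma n : wpre (l + n) = (gamma * wpre n)%g.
Proof.
rewrite wpreD gammaE; congr (_ * _)%g.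
by apply: eq_bigr => j _; rewrite modnDl.
Qed.

Lemma rho_gamma n : rho (l + n) = gamma · rho n.
Proof.
by rewrite /Defs.rho wpre_gamma modnDl actM ?gamma_in ?wpre_in.
Qed.

Definition unwind n x := (wpre n)^-1%g · x.

Lemma unwind0 x : unwind 0 x = x.
Proof. by rewrite /unwind big_geq // invg1 act1. Qed.

Lemma unwindS n x : unwind n.+1 x = refl sigma`_(letter n) · unwind n x.
Proof.
rewrite /unwind big_nat_recr //= invMg actM ?groupV ?wpre_in //.
  by rewrite reflV //; apply: Phi_letter.
exact/refl_in/Phi_letter.
Qed.

Lemma unwind_rho n : unwind n (rho n) = sigma`_(letter n).
Proof. by rewrite /unwind /Defs.rho actKV ?wpre_in. Qed.

Lemma unwind_eq n x a : unwind n x = a -> x = wpre n · a.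
Proof. by move=> <-; rewrite actVK ?wpre_in. Qed.

Lemma Phi_unwind n x : Phi x -> Phi (unwind n x).
Proof. by apply: Phi_act; rewrite groupV wpre_in. Qed.

(** By [pos_flip] the sign can change at step [m] only if the unwound vector is the simple root of
    that letter up to sign, that is, if [x] is [rho m] up to sign. *)
Lemma pos_unwind n x : Phi x ->
  (forall m, (m < n)%N -> x <> rho m /\ x <> - rho m) ->
  pos (unwind n x) = pos x.
Proof.
move=> Px; elim: n => [|n IHn] notx; first by rewrite unwind0.
rewrite -IHn => [|m mn]; last by apply: notx; rewrite ltnW.
have [xn xNn] := notx n (ltnSn n); rewrite unwindS.
have Pu := Phi_unwind n Px; set y := unwind n x in Pu *.
apply/idP/idP => [|py].
  apply: contraLR; rewrite -Phi_posN // => pNy.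
  rewrite -Phi_posN; last by apply: Phi_act => //; apply/refl_in/Phi_letter.
  apply/negPn/negP => npNy; case: xNn.
  rewrite -mulmxN in npNy; have /esym := pos_flip (PhiN Pu) pNy npNy.
  move/(congr1 -%R); rewrite opprK => /esym /unwind_eq ->.
  by rewrite mulmxN.
apply/negPn/negP => npy; case: xn.
by have /unwind_eq := pos_flip Pu py npy.
Qed.

(** The list may repeat reflections; [list_lt] places each at its first occurrence, and the sign
    estimates hold there. *)
Definition first_rho n := forall m, (m < n)%N -> refl (rho n) != refl (rho m).

Lemma first_rhoP n : first_rho n ->
  forall m, (m < n)%N -> rho n <> rho m /\ rho n <> - rho m.
Proof.
move=> fn m /fn nm; split=> E; case/eqP: nm; rewrite E; first by [].
exact: refl_opp (Phi_rho m).
Qed.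

Lemma first_rho_pos_unwind n m :
  first_rho n -> (m <= n)%N -> pos (unwind m (rho n)).
Proof.
move=> /first_rhoP fn mn; rewrite pos_unwind => [||k km]; first 1 last.
- exact: Phi_rho.
- by apply: fn; apply: leq_trans mn.
by rewrite -(pos_unwind (n := n)) ?unwind_rho ?pos_sigma //; apply: Phi_rho.
Qed.

Lemma first_rho_gamma n : first_rho (l + n) -> first_rho n.
Proof.
move=> fn m mn; have /fn : (l + m < l + n)%N by rewrite ltn_add2l.
apply: contraNneq => E; rewrite !rho_gamma.
by rewrite !(refl_act gamma_in (Phi_rho _)) E.
Qed.

(** The cyclic word read from position [n]; its product is the conjugate of [gamma] by the prefix of
    length [n], see [reflect_seq_rotation]. *)
Definition rotation n := [seq sigma`_(letter (n + j)) | j <- iota 0 l].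

Lemma mem_rotation n (i : 'I_l) :
  i != letter n -> sigma`_i \in behead (rotation n).
Proof.
(* [k] is the distance from position [n] to the next occurrence of the letter [i]. *)
move=> ni; apply/(nthP 0); pose k := ((i + (l - n %% l)) %% l)%N.
have kl : (k < l)%N by rewrite /k ltn_pmod.
have nk : ((n + k) %% l = i)%N.
  rewrite modnDmr -modnDml addnCA subnKC; last exact/ltnW/ltn_pmod.
  by rewrite modnDr modn_small.
have k0 : (0 < k)%N.
  rewrite lt0n; apply: contraNneq ni => k0; apply/eqP/val_inj => /=.
  by rewrite -nk k0 addn0.
exists k.-1; first by rewrite size_behead size_map size_iota; lia.
rewrite nth_behead prednK // (nth_map 0%N) ?size_iota // nth_iota //.
by rewrite add0n /= nk.
Qed.

Lemma rotation_cons n : rotation n = sigma`_(letter n) :: behead (rotation n).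
Proof. by rewrite /rotation -[X in iota _ X](prednK l_gt0) /= addn0. Qed.

Lemma rotation_free n : free (rotation n).
Proof.
have sub : {subset sigma <= rotation n}.
  move=> a asig; rewrite -(nth_index 0 asig).
  have il : (index a sigma < l)%N.
    by rewrite -[X in (_ < X)%N](size_tuple sigma) index_mem.
  have [E|/mem_rotation] := eqVneq (Ordinal il) (letter n).
    have -> : sigma`_(index a sigma) = sigma`_(letter n) by rewrite -E.
    by rewrite rotation_cons mem_head.
  by rewrite /= rotation_cons inE orbC => ->.
rewrite /free eqn_leq dim_span size_map size_iota /=.
have /subvP full := sub_span sub.
have -> : <<rotation n>>%VS = fullv.
  by apply/eqP; rewrite eqEsubv subvf -span_sigma; apply/subvP.
by rewrite dimvf dim_matrix mulr1 leqnn.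
Qed.

Lemma reflect_seq_rotation n x :
  reflect_seq (rotation n) x = unwind n (gamma · (wpre n · x)).
Proof.
rewrite /unwind -(actM x gamma_in (wpre_in n)) -wpre_gamma addnC wpreD.
have /rW_prod_seq : forall a, a \in rotation n -> Phi a.
  by move=> a /mapP[j _ ->]; apply: Phi_letter.
move=> /(_ x)[pW <-]; rewrite big_map in pW *.
rewrite (_ : index_iota 0 l = iota 0 l); last by rewrite /index_iota subn0.
by rewrite [in RHS]actM ?wpre_in // actKV ?wpre_in.
Qed.

Local Notation E := (euler (rW gamma)).

(** Let [rho n = p - gamma p] and unwind [p] to [q]. The rotated product moves [q] by its own first
    root, so [q] is orthogonal to every other simple root, and pairing with [q] sees a single
    coordinate. *)
Lemma euler_rho n y : exists2 c, 0 < c &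
  E (rho n) y = c * coef (letter n) (unwind n y).
Proof.
have [p pE] := eulerP gamma_unit (rho n).
have Pn := Phi_rho n; have [rn0 _ _] := Phi_refl Pn.
set q := unwind n p.
have dq z : dotv q (unwind n z) = dotv p z.
  by rewrite dotv_orthogonal //; apply/rW_orthogonal; rewrite groupV wpre_in.
have mv : q - reflect_seq (rotation n) q = sigma`_(letter n).
  rewrite reflect_seq_rotation actVK ?wpre_in // /q /unwind -mulmxBr.
  by rewrite -pE -/(unwind n _) unwind_rho.
have q0 (i : 'I_l) : i != letter n -> dotv q sigma`_i = 0.
  move=> /mem_rotation ir; rewrite dotvC; move: ir.
  apply: (@reflect_seq_move _ _ [::] sigma`_(letter n));
    rewrite cat0s -rotation_cons //.
  exact: rotation_free.
(* The constant is found by taking [y = rho n], whose coordinate is 1. *)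
exists (E (rho n) (rho n)).
  by apply: euler_gt0 => //; [apply: gamma_orthogonal | apply: gamma_unit].
rewrite {1 2}pE !euler_subE ?gamma_unit // -!dq unwind_rho.
rewrite {1}(coefE (unwind n y)) dotv_sumr (bigD1 (letter n)) //= big1 ?addr0.
  by rewrite dotvZr mulrC.
by move=> i /q0 qi; rewrite dotvZr qi mulr0.
Qed.

Lemma euler_rho_ge0 n m : first_rho n -> (m <= n)%N -> 0 <= E (rho m) (rho n).
Proof.
move=> fn mn; have [c c0 ->] := euler_rho m (rho n).
have /posP nn := first_rho_pos_unwind fn mn.
by apply: mulr_ge0; [apply: ltW | apply: nn].
Qed.

(** If [n < m + l], the letter [n] does not occur from [m] to [n - 1], and the coordinate in
    [euler_rho] is zero. Otherwise [rho n] is [gamma] applied to an earlier root that is not before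
    [rho m], and [euler_coxeter] reduces to [euler_rho_ge0]. *)
Lemma euler_rho_le0 n m : first_rho n -> first_rho m -> (m < n)%N ->
  E (rho n) (rho m) <= 0.
Proof.
move=> fn fm mn; have [nl|nl] := ltnP n (m + l).
  have [c _ ->] := euler_rho n (rho m).
  suff -> : coef (letter n) (unwind n (rho m)) = 0 by rewrite mulr0.
  (* The letter [n] stays fixed while the number [k] of unwound steps varies. *)
  move: mn {fn fm c}; move: {1 3 5}n (leqnn n) => k; elim: k => // k IHk kn.
  rewrite ltnS leq_eqVlt => /orP[/eqP mk|mk].
    have mn : (m < n)%N by rewrite mk.
    have nm := letter_neq mn nl.
    by rewrite -mk unwindS unwind_rho coef_reflect // coef_sigma (negPf nm).
  rewrite unwindS coef_reflect; first exact: IHk (ltnW kn) mk.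
  by apply: letter_neq => //; apply: (leq_trans nl); rewrite leq_add2r ltnW.
have [k nE] : exists k : nat, n = (l + k)%N.
  by exists (n - l)%N; rewrite subnKC // (leq_trans _ nl) ?leq_addl.
rewrite nE rho_gamma euler_coxeter; first last.
- exact: gamma_unit.
- exact: gamma_orthogonal.
rewrite oppr_le0; apply: euler_rho_ge0.
  by apply: first_rho_gamma; rewrite -nE.
by rewrite -(leq_add2l l) -nE addnC.
Qed.

End Rho.

(** * Bipartite Coxeter elements *)

Section Bipartite.

Variable r : nat.
Implicit Types (b : bool).
Hypotheses (hr : (r <= l)%N) (hleft : orthonormal_seq (take r sigma)).
Hypothesis hright : orthonormal_seq (drop r sigma).

Local Notation h := #[gamma]%g.

Definition side (i : 'I_l) := (i < r)%N.

Definition half b := if b then take r sigma else drop r sigma.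

Definition half_prod b := (\prod_(a <- half b) refl a)%g.

Lemma half_orthonormal b : orthonormal_seq (half b).
Proof. by case: b. Qed.

Lemma big_half b (F : 'cV[R]_l -> 'cV[R]_l) :
  \sum_(a <- half b) F a = \sum_(i < l | side i == b) F sigma`_i.
Proof.
have trueE : \sum_(a <- take r sigma) F a = \sum_(i < l | side i) F sigma`_i.
  rewrite -(big_ord_widen _ (fun i => F sigma`_i) hr) (big_nth 0).
  rewrite size_takel ?size_tuple // big_mkord.
  by apply: eq_bigr => i _; rewrite nth_take.
case: b => /=; first by rewrite trueE; apply: eq_bigl => i; rewrite eqb_id.
apply: (@addrI _ (\sum_(a <- take r sigma) F a)).
rewrite -big_cat cat_take_drop {1}trueE (big_nth 0) size_tuple big_mkord.
rewrite (bigID side) /=; congr (_ + _); apply: eq_bigl => i.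
by rewrite eqbF_neg.
Qed.

Lemma half_sub b a : a \in half b -> Phi a.
Proof.
by move=> ab; apply: Phi_sigma_mem; case: b ab => [/mem_take|/mem_drop].
Qed.

Lemma half_in b : half_prod b \in W.
Proof. by have [] := rW_prod_seq 0 (@half_sub b). Qed.

Lemma halfE b x : half_prod b · x =
  x - \sum_(i < l | side i == b) (2 * dotv sigma`_i x) *: sigma`_i.
Proof.
have [_ ->] := rW_prod_seq x (@half_sub b).
rewrite reflect_seq_orthonormal ?big_half //; exact: half_orthonormal.
Qed.

Lemma dotv_side (i j : 'I_l) :
  side i = side j -> dotv sigma`_i sigma`_j = (i == j)%:R.
Proof.
rewrite /side; case: (ltnP i r) => [ir /esym jr|ri /esym/negbT].
  have := hleft (i := i) (j := j); rewrite size_takel ?size_tuple //.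
  by rewrite !nth_take // => ->.
rewrite -leqNgt => rj; have := hright (i := (i - r)%N) (j := (j - r)%N).
rewrite size_drop size_tuple !ltn_sub2rE // !nth_drop !subnKC // => -> //.
by rewrite -(eqn_add2r r) !subnK.
Qed.

Lemma dotv_sigma1 (i : 'I_l) : dotv sigma`_i sigma`_i = 1.
Proof. by rewrite dotv_side // eqxx. Qed.

Lemma dotv_side_sum b (i : 'I_l) (c : 'I_l -> R) : side i = b ->
  dotv sigma`_i (\sum_(j < l | side j == b) c j *: sigma`_j) = c i.
Proof.
move=> ib; rewrite dotv_sumr (bigD1 i) ?ib //= dotvZr dotv_sigma1 mulr1.
rewrite big1 ?addr0 // => j /andP[/eqP jb ji].
by rewrite dotvZr dotv_side ?ib // eq_sym (negPf ji) mulr0.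
Qed.

Lemma half_invol b : (half_prod b * half_prod b = 1)%g.
Proof.
apply: act_faithful; rewrite ?groupM ?half_in // => x.
rewrite actM ?half_in // act1; set y := half_prod b · x.
rewrite halfE {1}/y halfE -addrA -opprD -big_split /= big1 ?subr0 // => i /eqP ib.
rewrite -scalerDl /y halfE dotvBr dotv_side_sum // -mulrDr.
by rewrite (_ : _ + _ = 0) ?mulr0 ?scale0r //; ring.
Qed.

Lemma halfK b x : half_prod b · (half_prod b · x) = x.
Proof. by rewrite -actM ?half_in // half_invol act1. Qed.

Lemma coef_half b (i : 'I_l) x :
  side i != b -> coef i (half_prod b · x) = coef i x.
Proof.
move=> ib; rewrite halfE linearB linear_sum /= big1 ?subr0 // => j jb.
rewrite linearZ /= coef_sigma; case: eqP => [ij|_]; last by rewrite mulr0.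
by rewrite ij jb in ib.
Qed.

Lemma half_sigma (i : 'I_l) : half_prod (side i) · sigma`_i = - sigma`_i.
Proof.
rewrite halfE (bigD1 i) //= dotv_sigma1 mulr1 big1 ?addr0.
  by rewrite scalerDl scale1r opprD addrA subrr sub0r.
by move=> j /andP[/eqP ji ij]; rewrite dotv_side // (negPf ij) mulr0 scale0r.
Qed.

Definition supported b x := forall i : 'I_l, side i != b -> coef i x = 0.

Lemma supported_half b x : supported b x -> half_prod b · x = - x.
Proof.
move=> bx; rewrite {1}(coefE x) [in RHS](coefE x) mulmx_sumr raddf_sum /=.
apply: eq_bigr => i _; rewrite -scalemxAr -scalerN.
case: (eqVneq (side i) b) => [<-|/bx->]; last by rewrite !scale0r.
by rewrite half_sigma.
Qed.

Lemma pos_flip_half b x : Phi x -> pos x -> ~~ pos (half_prod b · x) ->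
  supported b x.
Proof.
move=> Px px; rewrite -Phi_posN; last exact: Phi_act (half_in b) Px.
move=> npx i ib; apply/le_anti; rewrite (posP _ px) andbT.
by have /posP/(_ i) := npx; rewrite linearN /= coef_half // oppr_ge0.
Qed.

(** On an orthonormal side the scalar product with [sigma_i] is the coordinate, so reflecting in
    [sigma_i] reverses a positive coordinate, and [pos_flip] applies. *)
Lemma pos_supported b x : Phi x -> pos x -> supported b x ->
  exists2 i : 'I_l, side i = b & x = sigma`_i.
Proof.
move=> Px px bx; have [x0 _ _] := Phi_refl Px.
have [i ix] : exists i, coef i x != 0.
  apply/existsP; rewrite -[X in is_true X]negbK negb_exists.
  apply/negP => /forallP nx; case/negP: x0; apply/eqP/coef_inj => i.
  by rewrite linear0; apply/eqP/negPn/nx.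
have ib : side i = b.
  by case: (eqVneq (side i) b) => // /bx ix0; rewrite ix0 eqxx in ix.
exists i => //; apply: pos_flip => //; apply/negP => /posP/(_ i).
rewrite reflE; last exact: Phi_sigma.
rewrite linearB linearZ /= coef_sigma eqxx mulr1 dotv_sigma1 divr1.
rewrite (_ : dotv _ x = coef i x).
  have : 0 < coef i x by rewrite lt_neqAle eq_sym ix (posP _ px).
  by lra.
rewrite {1}(coefE x) (bigID (fun j => side j == b)) /= addrC big1 ?add0r.
  by rewrite dotv_side_sum.
by move=> j /bx->; rewrite scale0r.
Qed.

(** The alternating word of length [n] in the two involutions, with [half_prod b] acting first; with
    [b] true, even lengths give powers of the inverse of [gamma]. *)
Fixpoint alt b n : gT :=
  if n is n'.+1 then (half_prod (b (+) odd n') * alt b n')%g else 1%g.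

Lemma alt_in b n : alt b n \in W.
Proof. by elim: n => [|n IHn] /=; rewrite ?group1 // groupM ?half_in. Qed.

Lemma altS b n x : alt b n.+1 · x = half_prod (b (+) odd n) · (alt b n · x).
Proof. by rewrite /= actM ?half_in ?alt_in. Qed.

Lemma alt_add b n m :
  alt b (n + m) = (alt (b (+) odd n) m * alt b n)%g.
Proof.
elim: m => [|m IHm] /=; first by rewrite addn0 mul1g.
by rewrite addnS /= IHm mulgA oddD addbA.
Qed.

Lemma alt_add_act b n m x :
  alt b (n + m) · x = alt (b (+) odd n) m · (alt b n · x).
Proof. by rewrite alt_add actM ?alt_in. Qed.

Lemma gamma_halves : gamma = (half_prod true * half_prod false)%g.
Proof. by rewrite /half_prod -big_cat cat_take_drop. Qed.

Lemma alt_double b n :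
  alt b n.*2 = ((if b then gamma^-1 else gamma) ^+ n)%g.
Proof.
have halfV c : ((half_prod c)^-1 = half_prod c)%g.
  by apply/eqP; rewrite eq_invg_mul half_invol.
elim: n => // n IHn; rewrite doubleS -addn2 alt_add odd_double addbF IHn expgS.
congr (_ * _)%g; rewrite /= mulg1 addbF gamma_halves.
by case: b {IHn}; rewrite ?invMg ?halfV.
Qed.

Lemma alt_periodic b x : alt b h.*2 · x = x.
Proof.
by rewrite alt_double; case: b; rewrite ?expgVn expg_order ?invg1 act1.
Qed.

(** The factors after the flip read the same as those before it in reverse order, and each is an
    involution. *)
Lemma alt_retrace b x n m : alt b n.+1 · x = - (alt b n · x) ->
  (m <= n)%N -> alt b (n.+1 + m) · x = - (alt b (n - m) · x).
Proof.
move=> flip; elim: m => [|m IHm] mn; first by rewrite addn0 subn0.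
rewrite addnS altS IHm 1?ltnW // mulmxN; congr (- _).
have -> : (n - m = (n - m.+1).+1)%N by rewrite -subSn.
rewrite altS; have -> : odd (n.+1 + m) = odd (n - m.+1).
  rewrite addSnnS oddB // oddD //.
exact: halfK.
Qed.

(** A sum over the powers of [gamma] is fixed by [gamma], and [1 - gamma] is invertible. *)
Lemma alt_sum0 x : \sum_(k < h) (alt true k.*2 · x) = 0.
Proof.
pose F (k : nat) := (gamma^-1 ^+ k)%g · x.
have gX (k : nat) : (gamma^-1 ^+ k)%g \in W by rewrite groupX ?groupV ?gamma_in.
set z := \sum_(k < h) _; have zE : z = \sum_(k < h) F k.
  by apply: eq_bigr => k _; rewrite alt_double.
have zfix : gamma^-1%g · z = z.
  apply: (@addrI _ (F 0%N)); rewrite zE mulmx_sumr.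
  transitivity (\sum_(k < h.+1) F k).
    rewrite big_ord_recl; congr (_ + _); apply: eq_bigr => k _.
    by rewrite /F -actM ?groupV ?gamma_in // -expgS.
  by rewrite big_ord_recr addrC /F expgVn expg_order invg1.
have {zfix}gz : gamma · z = z by rewrite -[in LHS]zfix actVK ?gamma_in.
by rewrite -[LHS](mulKmx gamma_unit) -/z mulmxBl mul1mx gz subrr mulmx0.
Qed.

Lemma Phi_alt b n x : Phi x -> Phi (alt b n · x).
Proof. exact: Phi_act (alt_in b n). Qed.

Lemma alt_flip b n x : Phi x ->
  pos (alt b n · x) -> ~~ pos (alt b n.+1 · x) ->
  supported (b (+) odd n) (alt b n · x) /\ alt b n.+1 · x = - (alt b n · x).
Proof.
move=> Px px; rewrite altS => npx.
have sx := pos_flip_half (Phi_alt b n Px) px npx.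
by rewrite supported_half.
Qed.

(** If all terms of the zero sum in [alt_sum0] were positive, its first term [x] would vanish. *)
Lemma exists_flip x : Phi x -> pos x ->
  exists2 k, (k < h)%N & ~~ pos (alt true k.*2 · x).
Proof.
move=> Px px; have [x0 _ _] := Phi_refl Px.
have [/existsP[k nk]|/existsPn all_pos] :=
  boolP [exists k : 'I_h, ~~ pos (alt true k.*2 · x)].
  by exists k.
case/negP: x0; apply/eqP/coef_inj => i; rewrite linear0.
have := congr1 (fun y => coef i y) (alt_sum0 x); rewrite linear_sum linear0 /=.
have h0 : (0 < h)%N by apply: order_gt0.
rewrite (bigD1 (Ordinal h0)) //= act1.
have : 0 <= \sum_(k < h | k != Ordinal h0) coef i (alt true k.*2 · x).
  by apply: sumr_ge0 => k _; apply: posP; apply/negPn/all_pos.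
by have /posP/(_ i) := px; lra.
Qed.

(* Were the first sign change later than the first [h] steps, [alt_retrace]
   would make the [2h]-th vector, which is [x] again, negative. *)
Lemma first_flip x : Phi x -> pos x -> exists n (i : 'I_l),
  [/\ (n < h)%N, side i = ~~ odd n & alt true n · x = sigma`_i].
Proof.
move=> Px px; have [k kh nk] := exists_flip Px px.
have ex : exists n, ~~ pos (alt true n · x) by exists k.*2.
case: (ex_minnP ex) => -[|n] npn minn; first by rewrite act1 px in npn.
have posn (m : nat) : (m <= n)%N -> pos (alt true m · x).
  by move=> mn; apply: contraLR mn => /minn; rewrite -ltnNge.
have [sx flip] := alt_flip Px (posn n (leqnn n)) npn.
have nh : (n < h)%N.
  rewrite ltnNge; apply/negP => hn.
  have nk2 : (n.+1 <= k.*2)%N by apply: minn.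
  have n2h : (n.+1 <= h.*2)%N by rewrite (leq_trans nk2) // leq_double ltnW.
  have mn : (h.*2 - n.+1 <= n)%N by rewrite -addnn leq_subLR; lia.
  have := alt_retrace flip mn; rewrite subnKC // alt_periodic => xE.
  have := px; rewrite xE Phi_posN; last exact: Phi_alt.
  by rewrite posn // leq_subr.
have [i ib iE] := pos_supported (Phi_alt true n Px) (posn n (leqnn n)) sx.
by exists n, i; split.
Qed.

(** * The list of roots in terms of alternating words *)

Section BipartiteRho.

Hypothesis l_gt0 : (0 < l)%N.

(** Each pass through the [l] letters consists of two blocks, the left and the right half; this is
    the index of the block containing position [n]. *)
Definition block n := ((n %/ l).*2 + (r <= n %% l))%N.

Lemma prod_letters_fix (s : seq nat) y :
  (forall j, j \in s -> dotv sigma`_(j %% l)%N y = 0) ->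
  (\prod_(j <- s) refl sigma`_(j %% l)%N)%g · y = y.
Proof.
elim: s => [|j s IHs] ort; first by rewrite big_nil act1.
have Pj := Phi_letter l_gt0 j.
rewrite big_cons actM ?refl_in //; last first.
  by apply: group_prod => i _; apply/refl_in/Phi_letter.
rewrite IHs => [|i si]; last by rewrite ort // inE si orbT.
by rewrite reflE // ort ?mem_head // mulr0 scale0r subr0.
Qed.

Lemma rho_lt (i : 'I_l) :
  rho i = if side i then sigma`_i else half_prod true · sigma`_i.
Proof.
rewrite /Defs.rho modn_small //; case: ifP => ir.
  apply: prod_letters_fix => j; rewrite mem_index_iota => ji.
  have jl : (j < l)%N by apply: leq_trans (ltn_ord i); apply: ltnW.
  rewrite modn_small // (@dotv_side (Ordinal jl)) //=.
    by rewrite -val_eqE /= ltn_eqF.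
  by rewrite ir /side /= (ltn_trans ji ir).
have ri : (r <= i)%N by rewrite leqNgt -/(side i) ir.
rewrite (big_cat_nat (leq0n r) ri) /= actM; first last.
- by apply: group_prod => j _; apply/refl_in/Phi_letter.
- exact: wpre_in.
rewrite (prod_letters_fix (s := index_iota r i)); last first.
  move=> j; rewrite mem_index_iota => /andP[rj ji].
  have jl : (j < l)%N by apply: ltn_trans ji (ltn_ord i).
  rewrite modn_small // (@dotv_side (Ordinal jl)) //=.
    by rewrite -val_eqE /= ltn_eqF.
  by rewrite ir /side /= ltnNge rj.
congr (rW _ *m _); rewrite /half_prod /= [RHS](big_nth 0) size_takel; last first.
  by rewrite size_tuple.
rewrite big_nat [RHS]big_nat; apply: eq_bigr => j /andP[_ jr].
by rewrite (nth_take _ jr) (modn_small (leq_trans jr hr)).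
Qed.

Lemma rho_gammaX q n : rho (q * l + n) = (gamma ^+ q)%g · rho n.
Proof.
elim: q => [|q IHq]; first by rewrite act1.
rewrite mulSn -addnA (rho_gamma l_gt0) IHq expgS actM ?groupX //; exact: gamma_in.
Qed.

Lemma alt_block n : alt true (block n) · rho n = sigma`_(letter l_gt0 n).
Proof.
have nE : rho n = (gamma ^+ (n %/ l))%g · rho (letter l_gt0 n).
  by rewrite -rho_gammaX -divn_eq.
have gX := groupX (n %/ l) gamma_in.
rewrite alt_add_act odd_double addbF alt_double nE expgVn actKV //.
rewrite rho_lt /side /= ltnNge; case: leqP => _ /=; last by rewrite act1.
by rewrite mulg1 halfK.
Qed.

Lemma trace_half b :
  \tr (rW (half_prod b)) = l%:R - 2 * #|[pred i | side i == b]|%:R.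
Proof.
have -> : rW (half_prod b) =
    1%:M - 2 *: \sum_(i < l | side i == b) (sigma`_i *m (sigma`_i)^T).
  apply: mulmx_cV_inj => x; rewrite halfE mulmxBl mul1mx -scalemxAl mulmx_suml.
  rewrite scaler_sumr; congr (_ - _); apply: eq_bigr => i _.
  by rewrite -mulmxA [_^T *m x]mx11_scalar mul_mx_scalar scalerA.
rewrite linearB linearZ /= mxtrace1 linear_sum /= -sum1_card natr_sum.
congr (_ - _ * _); apply: eq_bigr => i _.
by rewrite mxtrace_mulC trace_mx11; apply: dotv_sigma1.
Qed.

(* For odd [h] the two halves are conjugate in the dihedral group that they
   generate, so that their traces agree. *)
Lemma odd_coxeter_number : odd h -> r.*2 = l.
Proof.
move=> oh; have gW := gamma_in; set a := half_prod true; set b := half_prod false.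
have aa : (a * a = 1)%g := half_invol true.
have bb : (b * b = 1)%g := half_invol false.
have ga : (gamma ^ a = gamma^-1)%g.
  have aV : (a^-1 = a)%g by apply/eqP; rewrite eq_invg_mul aa.
  have bV : (b^-1 = b)%g by apply/eqP; rewrite eq_invg_mul bb.
  by rewrite conjgE gamma_halves -/a -/b invMg aV bV !mulgA aa mul1g.
pose m := h./2; have hE : h = m.*2.+1 by rewrite -[LHS]odd_double_half oh.
have gma : (gamma ^+ m * a = a * gamma ^- m)%g.
  by rewrite -expgVn -ga -conjXg conjgE !mulgA mulgV mul1g.
have conj : (gamma ^+ m * a * gamma ^- m = b)%g.
  rewrite gma -mulgA -expgVn -expgD addnn.
  have -> : (gamma^-1 ^+ m.*2 = gamma)%g.
    by apply/eqP; rewrite expgVn eq_invg_mul -expgSr -hE expg_order.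
  by rewrite gamma_halves mulgA aa mul1g.
have : \tr (rW b) = \tr (rW a).
  rewrite -conj !repr_mxM ?groupM ?groupV ?groupX ?half_in //.
  rewrite mxtrace_mulC mulmxA -repr_mxM ?groupV ?groupX //.
  by rewrite mulVg repr_mx1 mul1mx.
rewrite /a /b !trace_half => /addrI/oppr_inj/mulfI.
rewrite pnatr_eq0 => /(_ isT)/eqP; rewrite eqr_nat => /eqP E.
have rE : #|[pred i : 'I_l | side i == true]| = r.
  rewrite -sum1_card -[RHS]card_ord -sum1_card (big_ord_widen _ (fun=> 1%N) hr).
  by apply: eq_bigl => i; rewrite !inE eqb_id.
have := cardC [pred i : 'I_l | side i == true].
rewrite rE card_ord -addnn => <-; congr addn; rewrite -rE -E.
by apply: eq_card => i; rewrite !inE; case: side.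
Qed.

(** The list consists of the first [h] blocks. For odd [h] it stops within a pass, and [r = l / 2]
    makes this a block boundary. *)
Lemma block_lt n : (block n < h)%N = (n < (l * h)./2)%N.
Proof.
rewrite /block {3}(divn_eq n l); have := ltn_pmod n l_gt0.
move: (n %/ l)%N (n %% l)%N => q s sl; case: (boolP (odd h)) => oh.
  have rl := odd_coxeter_number oh.
  have [m ->] : exists m : nat, h = m.*2.+1.
    by exists h./2; rewrite -[LHS]odd_double_half oh.
  have -> : ((l * m.*2.+1)./2 = m * l + r)%N.
    by rewrite -rl -doubleMl doubleK mulnS addnC -!doubleMr mulnC.
  have [qm|mq|->] := ltngtP q m.
  - have : (q.+1 * l <= m * l)%N by rewrite leq_mul2r qm orbT.
    by rewrite mulSn; case: (r <= s)%N; lia.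
  - have : (m.+1 * l <= q * l)%N by rewrite leq_mul2r mq orbT.
    by rewrite mulSn; case: (r <= s)%N; lia.
  by rewrite ltn_add2l; case: leqP; lia.
have [m ->] : exists m : nat, h = m.*2.
  by exists h./2; rewrite -[LHS]odd_double_half (negPf oh).
rewrite -doubleMr doubleK; have [qm|mq] := ltnP q m.
  have : (q.+1 * l <= m * l)%N by rewrite leq_mul2r qm orbT.
  by rewrite mulSn (mulnC l m); case: (r <= s)%N; lia.
have : (m * l <= q * l)%N by rewrite leq_mul2r mq orbT.
by rewrite (mulnC l m); case: (r <= s)%N; lia.
Qed.

Lemma mem_rho_seq x :
  reflect (exists2 n, (n < (l * h)./2)%N & x = rho n) (x \in rho_seq rW sigma).
Proof.
apply: (iffP mapP) => [[n]|[n nlt ->]].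
  by rewrite mem_iota => ? ->; exists n.
by exists n; rewrite ?mem_iota.
Qed.

Lemma pos_mem_rho_seq x : Phi x -> pos x -> x \in rho_seq rW sigma.
Proof.
move=> Px px; have [n [i [nh ni xi]]] := first_flip Px px.
(* The position of the letter [i] in the pass that contains block [n]. *)
pose N := (n./2 * l + i)%N; have Nq : (N %/ l = n./2)%N.
  by rewrite divnMDl // divn_small ?addn0.
have Nr : (N %% l = i)%N by rewrite modnMDl modn_small.
have bN : block N = n.
  rewrite /block Nq Nr leqNgt -/(side i) ni negbK.
  by rewrite addnC odd_double_half.
apply/mem_rho_seq; exists N; first by rewrite -block_lt bN.
apply: (act_inj (alt_in true n)); rewrite -{2}bN alt_block /= xi.
by congr nth; rewrite Nr.
Qed.

Lemma mem_reflections t : t \in T -> exists2 a, PhiP a & refl a = t.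
Proof.
move=> tT; case: hPhi => -[alpha [alphaP PE]] _.
have [a0 ta] := alphaP t tT.
have Pa : Phi (alpha t) by apply/PE; exists t => //; left.
have rt a : Phi a -> reflection_mx a = reflection_mx (alpha t) -> refl a = t.
  move=> Pa' E; apply: (rW_inj (refl_in Pa') (reflections_sub tT)).
  by have [_ _ ->] := Phi_refl Pa'; rewrite E ta.
have [pa|] := boolP (pos (alpha t)).
  by exists (alpha t); [apply/PhiPE | apply: rt].
rewrite -Phi_posN // => pa; have PNa := PhiN Pa.
by exists (- alpha t); [apply/PhiPE | apply: rt; rewrite ?reflection_mxN].
Qed.

(** * Orbits of simple roots and repetitions in the list *)

Local Arguments alt : simpl never.

Lemma alt_shift b n x :
  alt b n.+1 · x = alt (~~ b) n · (half_prod b · x).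
Proof. by rewrite -(add1n n) alt_add_act addbT altS act1 addbF. Qed.

(** The half not containing [i] acts first, since the other one only negates [sigma_i]. *)
Local Notation orbit i n := (alt (~~ side i) n · sigma`_i).

(** The first half sends [sigma_i] to itself plus multiples of simple roots of the other side; under
    the remaining word the term [sigma_i] becomes [- orbit i n]. *)
Lemma orbit_mesh (i : 'I_l) n : orbit i n.+2 + orbit i n =
  \sum_(j < l | side j == ~~ side i)
    (- 2 * dotv sigma`_j sigma`_i) *: orbit j n.+1.
Proof.
rewrite alt_shift negbK halfE mulmxBr [alt (side i) _ · sigma`_i]alt_shift.
rewrite half_sigma mulmxN addrAC addNr add0r.
rewrite mulmx_sumr -sumrN; apply: eq_bigr => j /eqP ji.
by rewrite -scalemxAr -scaleNr mulNr ji negbK.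
Qed.

Lemma Phi_orbit (i : 'I_l) n : Phi (orbit i n).
Proof. exact/Phi_alt/Phi_sigma. Qed.

(* By the mesh relation the positive vectors [orbit j n.-1], for [j] adjacent
   to [i], have a sum supported on one side, hence are themselves supported
   there and change sign at step [n] too. *)
Lemma orbit_propagate n (i j : 'I_l) :
  (forall (k : 'I_l) m, (m < n)%N -> pos (orbit k m)) ->
  ~~ pos (orbit i n) -> dotv sigma`_j sigma`_i != 0 -> ~~ pos (orbit j n).
Proof.
move=> posn npi ji; have [->//|ij] := eqVneq j i.
have sij : side j = ~~ side i.
  have [s|] := eqVneq (side j) (side i); last by do 2 case: side.
  by case/eqP: ji; rewrite dotv_side // (negPf ij).
have neg2_ge0 (k : 'I_l) :
    side k = ~~ side i -> 0 <= - 2 * dotv sigma`_k sigma`_i.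
  move=> ki; rewrite mulNr oppr_ge0 pmulr_rle0 ?ltr0n //; apply: sigma_obtuse.
  by apply: contraTneq isT => E; move: ki; rewrite E; case: side.
case: n posn npi => [|[|n]] posn npi; first by rewrite act1 pos_sigma in npi.
  have p0 : pos (orbit i 0) by rewrite act1 pos_sigma.
  have [+ _] := alt_flip (Phi_sigma i) p0 npi.
  rewrite act1 => /(_ i); rewrite coef_sigma eqxx addbF => H.
  case/eqP: (oner_neq0 R).
  by apply: H; case: side.
have pn (k : 'I_l) : pos (orbit k n.+1) by apply: posn.
have [_ flip] := alt_flip (Phi_sigma i) (pn i) npi.
set c := ~~ side i (+) odd n.
have sc : supported c (orbit j n.+1).
  move=> q qc; have := congr1 (fun y => coef q y) (orbit_mesh i n).
  (* Off side [c], [orbit i n] and [orbit i n.+1] have the same coordinates, and [orbit i n.+2] is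
     the negative of the latter; so the nonnegative terms of the mesh sum all vanish there. *)
  have -> : coef q (orbit i n.+2 + orbit i n) = 0.
    rewrite linearD /= flip altS linearN /= coef_half ?addNr //.
  rewrite linear_sum /= => /esym/eqP; rewrite psumr_eq0 => [/allP H|k /eqP ki].
    have := H j; rewrite mem_index_enum sij eqxx linearZ /= => /(_ isT).
    by rewrite mulf_eq0 mulf_eq0 oppr_eq0 pnatr_eq0 (negPf ji) /= => /eqP.
  by rewrite linearZ /= mulr_ge0 ?neg2_ge0 //; apply: posP.
rewrite altS; have -> : ~~ side j (+) odd n.+1 = c.
  by rewrite sij /c /=; case: side; case: odd.
by rewrite supported_half // Phi_posN ?negbK ?pn //; apply: Phi_orbit.
Qed.

(** After the flip the orbit retraces to [- sigma_i], which the next half negates; this closes a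
    word of length twice [n.+1]. *)
Lemma gamma_fix_orbit (i : 'I_l) n :
  (forall m, (m <= n)%N -> pos (orbit i m)) -> ~~ pos (orbit i n.+1) ->
  (gamma ^+ n.+1)%g · sigma`_i = sigma`_i.
Proof.
move=> posn npi; have [_ flip] := alt_flip (Phi_sigma i) (posn n (leqnn n)) npi.
have := alt_retrace flip (leqnn n); rewrite subnn act1 => E.
have : alt (~~ side i) n.+1.*2 · sigma`_i = sigma`_i.
  rewrite doubleS -addnn -addSn altS E mulmxN.
  have -> : ~~ side i (+) odd (n.+1 + n) = side i.
    by rewrite addSn addnn /= odd_double addbT negbK.
  by rewrite half_sigma opprK.
rewrite alt_double; case: (~~ side i) => // {}E.
have gX := groupX n.+1 gamma_in.
by apply: (act_inj (groupVr gX)); rewrite actKV // -expgVn E.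
Qed.

(** The simple roots in [M] span a submodule, because the list of roots exhibits every reflection as
    a conjugate of a simple one by simple reflections. By irreducibility it is everything, so no
    simple root is orthogonal to it. *)
Lemma irreducible_connected (M : pred 'I_l) : mx_irreducible rW ->
  (exists i, M i) ->
  (forall i j, M i -> ~~ M j -> dotv sigma`_j sigma`_i = 0) -> forall i, M i.
Proof.
move=> /mx_irrP[_ irr] [i0 Mi0] ort.
(* Submodules are row spaces under right multiplication; as reflection matrices are symmetric,
   transposed roots serve. *)
pose U : 'M[R]_l := \matrix_i (if M i then (sigma`_i)^T else 0).
have rowU i : row i U = if M i then (sigma`_i)^T else 0 by rewrite rowK.
have Usigma (j : 'I_l) : ~~ M j -> U *m sigma`_j = 0.
  move=> nMj; apply/row_matrixP => i; rewrite row_mul rowU row0.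
  case: ifP => Mi; last by rewrite mul0mx.
  by rewrite [LHS]mx11_scalar -/(dotv _ _) dotvC ort // raddf0.
have Ut (j : 'I_l) : refl sigma`_j \in rstabs rW U.
  have Pj := Phi_sigma j; rewrite inE refl_in //=; have [_ _ ->] := Phi_refl Pj.
  rewrite mulmx_reflection addmx_sub // eqmx_opp scalemx_sub //.
  have [Mj|nMj] := boolP (M j).
    by rewrite mulmx_sub // -[(sigma`_j)^T](_ : row j U = _) ?row_sub // rowU Mj.
  by rewrite Usigma // mul0mx sub0mx.
have mod : mxmodule rW U.
  have WT : W \subset <<T>>%g by case: hW => _ _ <-.
  apply: (fintype.subset_trans WT); rewrite gen_subG; apply/fintype.subsetP => t.
  move=> /mem_reflections[a /PhiPE[Pa pa] <-].
  have /mem_rho_seq[n _ ->] := pos_mem_rho_seq Pa pa.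
  have Un (k : nat) : refl sigma`_(k %% l)%N \in rstabs rW U.
    exact: (Ut (letter l_gt0 k)).
  have wn : (\prod_(0 <= j < n) refl sigma`_(j %% l)%N)%g \in rstabs rW U.
    by apply: group_prod => k _; apply: Un.
  rewrite /Defs.rho refl_act ?wpre_in //; last exact: Phi_letter.
  by rewrite groupM ?groupV // groupM.
have U0 : U != 0.
  apply/eqP => U0; have := rowU i0; rewrite Mi0 U0 row0 => /esym/eqP.
  rewrite trmx_eq0; have [/negP H _ _] := Phi_refl (Phi_sigma i0).
  by move=> /H.
have /row_fullP[B BU] := irr U mod U0.
move=> j; apply/negPn/negP => /Usigma Uj.
have [s0 _ _] := Phi_refl (Phi_sigma j); case/negP: s0.
by rewrite -[sigma`_j]mul1mx -BU -mulmxA Uj mulmx0 eqxx.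
Qed.

Lemma alt_block_flip n :
  alt true (block n).+1 · rho n = - (alt true (block n) · rho n).
Proof.
rewrite altS alt_block -half_sigma; congr (rW (half_prod _) *m _).
by rewrite /block oddD odd_double /side /= ltnNge; case: leqP.
Qed.

(* Two occurrences of the same reflection in distinct blocks cut out an orbit
   segment of a simple root along which the sign changes. *)
Lemma repeated_rho n m : (block n < block m)%N ->
  rho m = rho n \/ rho m = - rho n ->
  exists2 k, (k <= block m - block n)%N & exists i : 'I_l, ~~ pos (orbit i k).
Proof.
move=> nm mn; pose d := (block m - (block n).+1)%N.
have dE : block m = ((block n).+1 + d)%N by rewrite subnKC.
have dE' : (block m - block n = d.+1)%N by rewrite dE addSn -addnS addKn.
pose i := letter l_gt0 n.
have orbE (k : nat) : alt true ((block n).+1 + k) · rho n = - orbit i k.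
  rewrite alt_add_act alt_block_flip alt_block mulmxN.
  congr (- (rW (alt _ _) *m _)).
  by rewrite /block /= oddD odd_double /side /= ltnNge; case: leqP.
have flip : orbit i d.+1 = - orbit i d.
  apply: oppr_inj; rewrite -!orbE addnS -dE.
  by have := alt_block_flip m; case: mn => [->//|->]; rewrite !mulmxN => /oppr_inj.
have [pd|npd] := boolP (pos (orbit i d)).
  exists d.+1; first by rewrite dE'.
  by exists i; rewrite flip Phi_posN ?negbK //; apply: Phi_orbit.
by exists d; [rewrite dE' | exists i].
Qed.

(** At the least step where some orbit turns negative, all of them do by connectedness. The
    corresponding power of [gamma] then fixes every simple root, although its exponent is below
    [h]. *)
Lemma irreducible_block_inj n m : mx_irreducible rW ->
  (block n < block m)%N -> (block m < h)%N ->
  rho m = rho n \/ rho m = - rho n -> False.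
Proof.
move=> irr nm mh /(repeated_rho nm)[k km [i npi]].
have ex : exists k, [exists i : 'I_l, ~~ pos (orbit i k)].
  by exists k; apply/existsP; exists i.
case: (ex_minnP ex) => L /existsP[i0 npi0] minL.
have posL (j : 'I_l) p : (p < L)%N -> pos (orbit j p).
  move=> pL; apply: contraLR pL => np; rewrite -leqNgt minL //.
  by apply/existsP; exists j.
have all_neg : forall j : 'I_l, ~~ pos (orbit j L).
  apply: irreducible_connected => //; first by exists i0.
  move=> j j' npj pj'; apply/eqP.
  by apply: contraNT pj' => /(orbit_propagate posL npj) ->.
case: L minL npi0 posL all_neg => [|L] minL npi0 posL all_neg.
  by rewrite act1 pos_sigma in npi0.
have gL : (gamma ^+ L.+1 = 1)%g.
  apply: act_faithful; rewrite ?groupX ?gamma_in // => x.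
  rewrite act1 (coefE x) mulmx_sumr; apply: eq_bigr => j _; rewrite -scalemxAr.
  by rewrite gamma_fix_orbit // => p pL; apply: posL.
have hL : (h <= L.+1)%N by apply: dvdn_leq => //; rewrite order_dvdn gL eqxx.
have Lk : (L.+1 <= k)%N by apply: minL; apply/existsP; exists i.
have := leq_trans hL (leq_trans Lk km).
by rewrite leqNgt (leq_ltn_trans (leq_subr _ _) mh).
Qed.

Lemma block_homo n m : (n < m)%N -> (block n <= block m)%N.
Proof.
move=> nm; rewrite /block; case: ltngtP (leq_div2r l (ltnW nm)) => // [q _|q _].
  apply: (@leq_trans (m %/ l).*2); last exact: leq_addr.
  by rewrite (leq_trans (leq_add (leqnn _) (leq_b1 _))) // addn1 ltn_double.
have sm : (n %% l <= m %% l)%N.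
  by move: nm; rewrite {1}(divn_eq n l) {1}(divn_eq m l) q ltn_add2l => /ltnW.
by rewrite q leq_add2l; case: (leqP r (n %% l)) => // rn; rewrite (leq_trans rn).
Qed.

Lemma refl_rho_neq n m : mx_irreducible rW -> (m < (l * h)./2)%N ->
  (n < m)%N -> refl (rho n) != refl (rho m).
Proof.
move=> irr; rewrite -block_lt => mh nm; apply/eqP => E.
have {E}mE := Phi_refl_eq (Phi_rho l_gt0 m) (Phi_rho l_gt0 n) (esym E).
have := block_homo nm.
rewrite leq_eqVlt => /orP[/eqP b|b]; last exact: irreducible_block_inj irr b mh mE.
(* Within one block the same element takes both roots to simple roots, so their letters agree, and
   hence their positions. *)
have := alt_block m; have := alt_block n; rewrite -b => nE mE'.
have {mE'}lE : letter l_gt0 m = letter l_gt0 n.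
  case: mE mE' => ->; rewrite ?mulmxN nE; first by move/sigma_inj.
  by move=> /esym/sigma_neqN.
move/(congr1 val): lE => /= lE; move: b; rewrite /block lE => /addIn/double_inj q.
by move: nm; rewrite (divn_eq n l) (divn_eq m l) q lE ltnn.
Qed.

End BipartiteRho.

(** * Labels of rising chains in the order given by the list *)

Local Notation ts := [seq refl a | a <- rho_seq rW sigma].

Lemma reflections_invol : {in T, forall t, (t * t = 1)%g}.
Proof. by move=> t /mem_reflections[a /PhiPE[Pa _] <-]; apply: refl_sqr. Qed.

Lemma reflections_neq1 : 1%g \notin T.
Proof.
apply/negP => /mem_reflections[a /PhiPE[Pa _] a1].
have [a0 _ _] := Phi_refl Pa; case/negP: (a0); rewrite -dotv_eq0 in a0.
have := reflE a Pa; rewrite a1 act1 divfK // => /esym/eqP.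
rewrite -subr_eq0 addrAC subrr sub0r oppr_eq0 scaler_eq0 pnatr_eq0.
by [].
Qed.

Lemma reflections_conj : {in T &, forall s t, (t ^ s)%g \in T}.
Proof.
move=> s t /reflections_sub sW /mem_reflections[a /PhiPE[Pa _] <-].
have sVW : (s^-1)%g \in W by rewrite groupV.
have := refl_act sVW Pa; rewrite invgK -mulgA -conjgE => <-.
by have [] := Phi_refl (Phi_act sVW Pa).
Qed.

Lemma reflections_gen : W :=: <<T>>%g.
Proof. by case: hW. Qed.

Lemma len_gamma : (abs_length T gamma <= l)%N.
Proof.
have := @abs_length_prod _ T [seq refl a | a <- sigma].
rewrite big_map size_map size_tuple; apply => t /mapP[a asig ->].
by have [] := Phi_refl (Phi_sigma_mem asig).
Qed.

Section RootOrder.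

Hypothesis l_gt0 : (0 < l)%N.

Lemma size_ts : size ts = (l * h)./2.
Proof. by rewrite !size_map size_iota. Qed.

Lemma nth_ts n : (n < (l * h)./2)%N -> nth 1%g ts n = refl (rho n).
Proof.
move=> nlt; rewrite (nth_map 0); last by rewrite size_mkseq.
by congr refl; apply: nth_mkseq.
Qed.

Lemma reflections_listed : {subset T <= ts}.
Proof.
move=> t /mem_reflections[a /PhiPE[Pa pa] <-].
exact/map_f/pos_mem_rho_seq.
Qed.

Definition root t := rho (index t ts).

Lemma index_ts t : t \in T -> (index t ts < (l * h)./2)%N.
Proof. by move=> /reflections_listed; rewrite -index_mem size_ts. Qed.

Lemma refl_root t : t \in T -> refl (root t) = t.
Proof.
by move=> tT; rewrite -(nth_ts (index_ts tT)) nth_index ?reflections_listed.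
Qed.

Lemma first_root t : t \in T -> first_rho (index t ts).
Proof.
move=> tT m mt; rewrite -/(root t) refl_root //.
rewrite -nth_ts; last exact: ltn_trans mt (index_ts tT).
by rewrite eq_sym; apply/negbT; have /= := before_find 1%g mt.
Qed.

Lemma reflect_seq_root (s : seq gT) v : {subset s <= T} ->
  reflect_seq [seq root t | t <- s] v = (\prod_(t <- s) t)%g · v.
Proof.
move=> sT; have Ps a : a \in [seq root t | t <- s] -> Phi a.
  by move=> /mapP[t _ ->]; apply: Phi_rho.
have [_ <-] := rW_prod_seq v Ps.
rewrite big_map; congr (rW _ *m _).
by rewrite big_seq [RHS]big_seq; apply: eq_bigr => t /sT /refl_root.
Qed.

Local Notation E := (euler (rW gamma)).

Lemma euler_root_ge0 s t : s \in T -> list_lt ts s t -> t \in T ->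
  0 <= E (root s) (root t).
Proof.
by move=> sT /ltnW st tT; apply: euler_rho_ge0 st => //; apply: first_root.
Qed.

Lemma euler_root_le0 s t : s \in T -> list_lt ts s t -> t \in T ->
  E (root t) (root s) <= 0.
Proof.
by move=> sT st tT; apply: (euler_rho_le0 l_gt0) st; apply: first_root.
Qed.

End RootOrder.

(** Reduced words of [x] and [y^-1 gamma], with the chain labels in between, factor [gamma] into at
    most [l] reflections. Replacing the labels by a reduced word that contains [t] gives the second
    factorization for [euler_tri_contra]. *)
Lemma rising_min (x y z : gT) (q : seq gT) t :
  x \in NC T W gamma -> y \in NC T W gamma ->
  maximal_chain (NC T W gamma) (abs_le T) x y (z :: q) ->
  rising (list_lt ts) (@natural_label gT) x (z :: q) ->
  t \in descents T (x^-1 * y)%g ->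
  ~~ list_lt ts t (natural_label x z).
Proof.
move=> xA yA ch rise td; apply/negP => lt_t; have /descentsP[tT _] := td.
have l_gt0 : (0 < l)%N.
  by have /mem_reflections[a /PhiPE[/Phi_dim]] := tT.
have xW := NC_in xA; have yW := NC_in yA; have gW := gamma_in.
have xyW : (x^-1 * y)%g \in W by rewrite groupM ?groupV.
have ygW : (y^-1 * gamma)%g \in W by rewrite groupM ?groupV.
have [sT sE _] := maximal_chainP reflections_gen gW reflections_neq1 ch.
have [/eqP xy sz] := maximal_chain_le reflections_gen gW reflections_neq1 xW yW ch.
move: sT sE rise; rewrite /rising /chain_label.
set s := pairmap _ _ _ => sT sE rise.
have szs : size s = abs_length T (x^-1 * y)%g by rewrite sz size_pairmap.
have [s1 [sz1 sT1 s1E]] := reduced_word reflections_gen xW.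
have [s2 [sz2 sT2 s2E]] := reduced_word reflections_gen ygW.
have [s' [sz' sT' ts' s'E]] := descents_reduced reflections_gen xyW td.
have /NCP[_ /eqP yg] := yA.
have total (u : seq gT) : size u = abs_length T (x^-1 * y)%g ->
    (size ([seq root t | t <- s1] ++ [seq root t | t <- u] ++
           [seq root t | t <- s2]) <= l)%N.
  move=> su; rewrite !size_cat !size_map sz1 su sz2 addnA xy yg.
  exact: len_gamma.
have product (u : seq gT) : {subset u <= T} ->
    (\prod_(t <- u) t)%g = (x^-1 * y)%g -> forall v,
    reflect_seq ([seq root t | t <- s1] ++ [seq root t | t <- u] ++
           [seq root t | t <- s2]) v = rW gamma *m v.
  move=> uT uE v; rewrite -!map_cat (reflect_seq_root l_gt0).
    by rewrite !big_cat /= -s1E uE -s2E mulgA !mulKVg.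
  by move=> a; rewrite !mem_cat => /or3P[/sT1|/uT|/sT2].
(* If [t] comes before the first label, it comes before all labels of the rising chain. *)
have lt_ts : {in s, forall u, list_lt ts t u}.
  have : path (list_lt ts) t s by apply/andP; split; [exact: lt_t | exact: rise].
  by move=> /order_path_min/allP; apply=> ? ? ?; apply: ltn_trans.
apply: (euler_tri_contra gamma_orthogonal gamma_unit (total s szs) (total s' sz')
  (product s sT sE) (product s' sT' (esym s'E)) (x := root t)).
- rewrite pairwise_map; move: rise; rewrite sorted_pairwise; last first.
    by move=> ? ? ?; apply: ltn_trans.
  have all_T : all (mem T) s by apply/allP.
  apply: (sub_in_pairwise (P := mem T)) all_T => a b aT bT ab.
  exact: euler_root_le0.
- exact: map_f.
- move=> _ /mapP[u us ->].
  exact: (euler_root_ge0 l_gt0 tT (lt_ts u us) (sT u us)).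
- move=> _ /mapP[u us ->].
  exact: (euler_root_le0 l_gt0 tT (lt_ts u us) (sT u us)).
Qed.

Lemma EL_natural_labeling : EL_labeling (NC T W gamma) (abs_le T) T (list_lt ts)
  (@natural_label gT).
Proof.
apply: (EL_of_rising_min reflections_gen gamma_in reflections_invol
  reflections_neq1 reflections_conj _ rising_min) => t tT.
have /mem_reflections[a /PhiPE[/Phi_dim l_gt0 _] _] := tT.
exact: reflections_listed.
Qed.

Lemma PhiP_mem_rho_seq a : PhiP a -> a \in rho_seq rW sigma.
Proof.
by move=> /PhiPE[Pa pa]; apply: pos_mem_rho_seq pa; rewrite ?(Phi_dim Pa).
Qed.

Lemma irreducible_uniq_ts : mx_irreducible rW -> uniq ts.
Proof.
move=> irr; have /mx_irrP[l_gt0 _] := irr; apply/(uniqP 1%g) => n m.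
rewrite !inE size_ts => nlt mlt; rewrite (nth_ts nlt) (nth_ts mlt).
have [nm|mn|->] := ltngtP n m; last by [].
  by move/eqP; rewrite (negPf (refl_rho_neq l_gt0 irr mlt nm)).
by move/esym/eqP; rewrite (negPf (refl_rho_neq l_gt0 irr nlt mn)).
Qed.

(** Were [rho n] negative, its opposite would be listed too, with the same reflection; without
    repetitions it sits at the same position, which is absurd. *)
Lemma uniq_rho_seq_PhiP a : uniq ts -> a \in rho_seq rW sigma -> PhiP a.
Proof.
move=> uts /mem_rho_seq[n nlt ->].
have l_gt0 : (0 < l)%N.
  have : (0 < l * h)%N by case: (l * h)%N nlt.
  by rewrite muln_gt0 => /andP[].
have Pn := Phi_rho l_gt0 n; apply/PhiPE; split => //.
apply/negPn/negP; rewrite -Phi_posN // => pNn.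
have /mem_rho_seq[m mlt mE] := pos_mem_rho_seq l_gt0 (PhiN Pn) pNn.
have nm : n = m.
  apply/eqP; rewrite -(nth_uniq 1%g _ _ uts) ?size_ts //.
  by rewrite (nth_ts nlt) (nth_ts mlt) -mE refl_opp.
by move: (Phi_posN Pn); rewrite {1}mE nm; case: pos.
Qed.

End Bipartite.
End RootSystem.

Theorem theorem4p2 (R : realType) (gT : finGroupType) (W : {group gT})
    (l : nat) (rW : mx_representation R W l)
    (Phi PhiP : set 'cV[R]_l) (sigma : l.-tuple 'cV[R]_l) (r : nat)
    (hW : reflection_group rW)
    (hPhi : root_system rW Phi)
    (hPhiP : positive_system Phi PhiP)
    (hsigma : simple_system_of Phi PhiP sigma)
    (hr : (r <= l)%N)
    (hleft : orthonormal_seq (take r sigma))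
    (hright : orthonormal_seq (drop r sigma)) :
  let T := reflections rW in
  let gamma := coxeter_element rW sigma in
  let rhos := rho_seq rW sigma in
  let ts := [seq root_reflection rW a | a <- rhos] in
  [/\ (forall a, PhiP a -> a \in rhos),
      (mx_irreducible rW -> uniq ts),
      (uniq ts -> forall a, PhiP a <-> a \in rhos)
    & EL_labeling (NC T W gamma) (abs_le T) T (list_lt ts)
        (@natural_label gT)].
Proof.
split.
- by move=> a; apply: (PhiP_mem_rho_seq hW hPhi hPhiP hsigma hr hleft hright).
- exact: (irreducible_uniq_ts hW hPhi hPhiP hsigma hr hleft hright).
- move=> uts a; split.
    by apply: (PhiP_mem_rho_seq hW hPhi hPhiP hsigma hr hleft hright).
  exact: (uniq_rho_seq_PhiP hW hPhi hPhiP hsigma hr hleft hright uts).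
exact: (EL_natural_labeling hW hPhi hPhiP hsigma hr hleft hright).
Qed.
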